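(* Let $\phi$ be a strictly positive functional belonging to the Szegő class. Then, as $n\to\infty$, in the algebra $\mathcal{R}_1$ (entrywise convergence), $$\Phi_n\rightarrow 0\qquad\text{and}\qquad (\Phi_n^\sharp)^{-1}\rightarrow\Theta_\phi .$$
   Context: Let $\mathcal{P}_2$ be the algebra of complex polynomials in two noncommuting indeterminates $X_1,X_2$, with the conjugate-linear involutive anti-automorphism $\mathcal{J}$ determined by $\mathcal{J}(X_1)=X_2$, $\mathcal{J}(X_2)=X_1$. A linear functional $\phi$ on $\mathcal{P}_2$ is strictly positive if $\phi(\mathcal{J}(P)P)>0$ for every nonzero polynomial $P$ in the single variable $X=X_1$. Put $s_{n,m}=K_\phi(n,m)=\phi(\mathcal{J}(X^n)X^m)$, $n,m\in\mathbb{N}_0=\{0,1,2,\dots\}$; all matrices $[s_{i,j}]_{0\le i,j\le n}$ are positive definite. Parameters: $\{\gamma_{k,j}\}_{0\le k<j}$ is the unique family of complex numbers with $|\gamma_{k,j}|<1$ such that, with $d_{k,j}=(1-|\gamma_{k,j}|^2)^{1/2}$, for all $k<j$ $$s_{k,j}=s_{k,k}^{1/2}\,(U_{k,j})_{1,1}\,s_{j,j}^{1/2},$$ where $U_{j,j}=1$ and $U_{k,j}=R_{k,k+1}R_{k,k+2}\cdots R_{k,j}(U_{k+1,j}\oplus 1)$ is a matrix of size $m=j-k+1$; here $R_{k,k+i}$ is the $m\times m$ identity matrix with its $2\times2$ block in rows and columns $i,i+1$ replaced by $\begin{bmatrix}\gamma_{k,k+i}& d_{k,k+i}\\ d_{k,k+i}&-\overline{\gamma}_{k,k+i}\end{bmatrix}$.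 Polynomials: for $n,l\in\mathbb{N}_0$ define $\varphi_0(X,l)=\varphi_0^\sharp(X,l)=s_{l,l}^{-1/2}$ and, for $n\ge1$, $$\varphi_n(X,l)=\tfrac{1}{d_{l,n+l}}\big(X\varphi_{n-1}(X,l+1)-\gamma_{l,n+l}\varphi^\sharp_{n-1}(X,l)\big),$$ $$\varphi^\sharp_n(X,l)=\tfrac{1}{d_{l,n+l}}\big(-\overline{\gamma}_{l,n+l}X\varphi_{n-1}(X,l+1)+\varphi^\sharp_{n-1}(X,l)\big).$$ ($\{\varphi_n(X,l)\}_{n\ge 0}$ are the orthonormal polynomials with positive leading coefficients for the inner product $\langle X^\beta,X^\alpha\rangle=s_{\alpha+l,\beta+l}$; $\varphi_n(X)=\varphi_n(X,0)$ are the orthogonal polynomials of $\phi$.) The algebra $\mathcal{R}_1$: all lower triangular arrays $a=[a_{k,j}]_{k,j\ge0}$ of complex numbers ($a_{k,j}=0$ for $k<j$; no boundedness assumed), with entrywise addition and multiplication $(ab)_{k,j}=\sum_{l\ge0}a_{k,l}b_{l,j}$ (a finite sum). A sequence $\{a_n\}\subset\mathcal{R}_1$ converges to $a\in\mathcal{R}_1$, written $a_n\to a$, if $(a_n)_{k,j}\to a_{k,j}$ for all $k,j\ge0$. Writing $\varphi_n(X,l)=\sum_{k=0}^n a^l_{n,k}X^k$ and $\varphi_n^\sharp(X,l)=\sum_{k=0}^n b^l_{n,k}X^k$ (with $a^l_{n,k}=b^l_{n,k}=0$ for $k>n$), define $\Phi_n,\Phi_n^\sharp\in\mathcal{R}_1$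 by $$(\Phi_n)_{k,j}=a^j_{n,k-j},\qquad (\Phi_n^\sharp)_{k,j}=b^j_{n,k-j}\quad (k\ge j),$$ and $0$ for $k<j$. The element $\Phi_n^\sharp$ is invertible in $\mathcal{R}_1$. Spectral factor: for a family $\mathcal{F}=\{\mathcal{F}_n\}_{n\ge0}$ with each $\mathcal{F}_n$ equal to $\{0\}$ or $\mathbb{C}$, consider lower triangular arrays $\Theta=[\Theta_{k,j}]_{k,j\ge 0}$ with $\Theta_{k,j}\in\mathcal{F}_k$, $\Theta_{k,j}=0$ for $k<j$, and each column $c_j(\Theta)=[\Theta_{k,j}]_{k\ge0}$ in the Hilbert space $\bigoplus_{k\ge j}\mathcal{F}_k$. Such $\Theta$ is outer if for every $k\ge0$ the set $\{c_j(\Theta):j\ge k\}$ is total in $\bigoplus_{j\ge k}\mathcal{F}_j$. Put $K_\Theta(k,j)=c_k(\Theta)^*c_j(\Theta)$, and for kernels write $K_1\le K_2$ if $K_2-K_1$ is a positive definite (i.e. positive semidefinite) kernel on $\mathbb{N}_0$. The spectral factor $\Theta_\phi$ of $K_\phi$ is the unique outer array with $K_{\Theta_\phi}\le K_\phi$, with $K_{\Theta'}\le K_{\Theta_\phi}$ for every outer $\Theta'$ (for any family $\mathcal{F}'$) satisfying $K_{\Theta'}\le K_\phi$, and normalized by $(\Theta_\phi)_{n,n}\ge0$ for all $n$. It is regarded as an element of $\mathcal{R}_1$. The functional $\phi$ belongs to the Szegő class if $(\Theta_\phi)_{n,n}>0$ for all $n\ge0$; equivalently, $s_{k,k}\prod_{n>k}d_{k,n}>0$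 for all $k\ge0$. *)

(* Defs.v *)
(* The complex field is R[i], R : realType. In its order, 0 < z and 0 <= z
   entail that z is real. *)
From HB Require Import structures.
From mathcomp Require Import all_boot all_order all_algebra complex.
(* monalg has to be imported before MathComp-Analysis: in the other order the
   notation levels clash. *)
From mathcomp Require Import finmap monalg.
From mathcomp Require Import boolp classical_sets functions reals topology.
From mathcomp Require Import normedtype sequences.

Set Implicit Arguments.
Unset Strict Implicit.
Unset Printing Implicit Defensive.

Import Order.TTheory GRing.Theory Num.Theory.
Import numFieldNormedType.Exports.

Local Open Scope classical_set_scope.
Local Open Scope ring_scope.

(* The monoid algebra of the free monoid on two letters; the letter false
   stands for X_1 and true for X_2. *)
Notation P2 R := {malg R[i][{fmonom bool}]}.

Section FreeAlgebra.
Variable R : realType.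
Local Notation C := R[i].

Definition X1 : P2 R := << fmu false >>.
Definition X2 : P2 R := << fmu true >>.

(* On words, J reverses the order and exchanges the two letters. *)
Definition Jword (w : {fmonom bool}) : {fmonom bool} :=
  FMonom (rev (map negb w)).

Definition J (P : P2 R) : P2 R :=
  \sum_(w <- msupp P) << (mcoeff w P)^* *g Jword w >>.

Definition in_X1 (p : {poly C}) : P2 R := \sum_(i < size p) p`_i *: X1 ^+ i.

Definition strictly_positive (phi : {scalar P2 R}) : Prop :=
  forall p : {poly C}, p != 0 -> 0 < phi (J (in_X1 p) * in_X1 p).

Definition moment_kernel (phi : {scalar P2 R}) (n m : nat) : C :=
  phi (J (X1 ^+ n) * X1 ^+ m).

End FreeAlgebra.

Section SchurParameters.
Variable R : realType.
Local Notation C := R[i].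
Implicit Types s gamma : nat -> nat -> C.

Definition defect gamma (k j : nat) : C := sqrtC (1 - `|gamma k j| ^+ 2).

(* Indices start at 0 here: the 2 x 2 block of rotation gamma k m p occupies
   rows and columns p, p + 1, so this is the matrix R_{k,k+i}, i = p + 1. *)
Definition rotation gamma (k m p : nat) : 'M[C]_m :=
  \matrix_(r < m, c < m)
    if (r == p :> nat) && (c == p :> nat) then gamma k (k + p.+1)%N
    else if (r == p :> nat) && (c == p.+1 :> nat) then defect gamma k (k + p.+1)
    else if (r == p.+1 :> nat) && (c == p :> nat) then defect gamma k (k + p.+1)
    else if (r == p.+1 :> nat) && (c == p.+1 :> nat)
      then - (gamma k (k + p.+1)%N)^*
    else (r == c)%:R.

(* Umx gamma k n is U_{k,k+n}, of size n + 1. *)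
Fixpoint Umx gamma (k n : nat) : 'M[C]_n.+1 :=
  match n with
  | 0 => 1%:M
  | n'.+1 =>
      (\prod_(p < n'.+1) rotation gamma k n'.+2 p) *m
      castmx (addn1 n'.+1, addn1 n'.+1)
             (block_mx (Umx gamma k.+1 n') 0 0 (1%:M : 'M_1))
  end.

(* Only the values gamma k j with k < j are meaningful. *)
Definition is_parameters s gamma : Prop :=
  (forall k j, (k < j)%N -> `|gamma k j| < 1) /\
  (forall k j, (k < j)%N ->
     s k j = sqrtC (s k k) * Umx gamma k (j - k) ord0 ord0 * sqrtC (s j j)).

(* The pair (phi_n(X,l), phi^sharp_n(X,l)). *)
Fixpoint orthopolys s gamma (n l : nat) : {poly C} * {poly C} :=
  match n with
  | 0 => (((sqrtC (s l l))^-1)%:P, ((sqrtC (s l l))^-1)%:P)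
  | n'.+1 =>
      let g := gamma l (n'.+1 + l)%N in
      let d := defect gamma l (n'.+1 + l) in
      let P := (orthopolys s gamma n' l.+1).1 in
      let Q := (orthopolys s gamma n' l).2 in
      (d^-1 *: ('X * P - g *: Q), d^-1 *: (- g^* *: ('X * P) + Q))
  end.

Definition orthopoly s gamma n l := (orthopolys s gamma n l).1.
Definition orthopoly_sharp s gamma n l := (orthopolys s gamma n l).2.

End SchurParameters.

Section TriangularAlgebra.
Variable R : realType.
Local Notation C := R[i].

Definition lower_triangular : {pred nat -> nat -> C} :=
  fun a => `[< forall k j, (k < j)%N -> a k j = 0 >].

Record R1 := MkR1 {
  R1_entry :> nat -> nat -> C;
  _ : R1_entry \in lower_triangular }.

HB.instance Definition _ := [isSub for R1_entry].
HB.instance Definition _ := [Choice of R1 by <:].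

Lemma R1_lower (a : R1) k j : (k < j)%N -> a k j = 0.
Proof. by have /asboolP := valP a; apply. Qed.

Lemma R1_eqP (a b : R1) : (forall k j, a k j = b k j) -> a = b.
Proof. by move=> ab; apply/val_inj/funext => k; apply/funext => j; apply: ab. Qed.

Fact lower_triangular_zmod_closed : zmod_closed lower_triangular.
Proof.
split=> [|a b /asboolP a0 /asboolP b0]; apply/asboolP => k j kj //.
by rewrite !fctE a0 // b0 // subr0.
Qed.
HB.instance Definition _ :=
  GRing.isZmodClosed.Build _ lower_triangular lower_triangular_zmod_closed.
HB.instance Definition _ := [SubChoice_isSubZmodule of R1 by <:].

Lemma R1_addE (a b : R1) k j : (a + b) k j = a k j + b k j.
Proof. by rewrite -[R1_entry (a + b)]/(val (a + b)) raddfD. Qed.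

Fact lower_part_subproof (f : nat -> nat -> C) :
  (fun k j => if (k < j)%N then 0 else f k j) \in lower_triangular.
Proof. by apply/asboolP => k j ->. Qed.
Definition lower_part (f : nat -> nat -> C) : R1 := MkR1 (lower_part_subproof f).

Definition R1_one : R1 := lower_part (fun k j => (k == j)%:R).

(* The terms with l > k of the sum over all l vanish. *)
Definition R1_mul (a b : R1) : R1 :=
  lower_part (fun k j => \sum_(l < k.+1) a k l * b l j).

Lemma R1_mulE (a b : R1) k j : R1_mul a b k j = \sum_(l < k.+1) a k l * b l j.
Proof.
rewrite /=; case: ltnP => // kj; rewrite big1 // => l _.
by rewrite (R1_lower b) ?mulr0 // (leq_ltn_trans _ kj) // -ltnS.
Qed.

Lemma R1_mulE_widen (a b : R1) N k j : (k < N)%N ->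
  R1_mul a b k j = \sum_(l < N) a k l * b l j.
Proof.
move=> kN; rewrite R1_mulE (big_ord_widen N (fun l => a k l * b l j)) //.
rewrite big_mkcond; apply: eq_bigr => l _; case: ltnP => // kl.
by rewrite (R1_lower a) ?mul0r.
Qed.

Lemma R1_oneE k j : R1_one k j = (k == j)%:R.
Proof. by rewrite /=; case: ltnP => // kj; rewrite (ltn_eqF kj). Qed.

Fact R1_mulA : associative R1_mul.
Proof.
move=> a b c; apply: R1_eqP => k j; rewrite (R1_mulE a) (R1_mulE (R1_mul a b)).
transitivity (\sum_(l < k.+1) \sum_(m < k.+1) a k l * b l m * c m j).
  apply: eq_bigr => l _; rewrite (R1_mulE_widen b c j (ltn_ord l)) mulr_sumr.
  by apply: eq_bigr => m _; rewrite mulrA.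
rewrite exchange_big; apply: eq_bigr => m _.
by rewrite (R1_mulE a b) mulr_suml.
Qed.

Fact R1_mul1 : left_id R1_one R1_mul.
Proof.
move=> a; apply: R1_eqP => k j; rewrite R1_mulE (bigD1 ord_max) //= big1.
  by rewrite ltnn eqxx mul1r addr0.
move=> l lk; rewrite -[X in X * _]/(R1_one k l) R1_oneE.
by rewrite eq_sym -[k]/(nat_of_ord (@ord_max k)) val_eqE (negbTE lk) mul0r.
Qed.

Fact R1_mulr1 : right_id R1_one R1_mul.
Proof.
move=> a; apply: R1_eqP => k j; have [kj|jk] := ltnP k j.
  by rewrite !R1_lower.
rewrite R1_mulE (bigD1 (Ordinal (jk : (j < k.+1)%N))) //= big1.
  by rewrite ltnn eqxx mulr1 addr0.
move=> l lj; rewrite -[X in _ * X]/(R1_one l j) R1_oneE.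
by rewrite -[j]/(nat_of_ord (Ordinal (jk : (j < k.+1)%N))) val_eqE (negbTE lj) mulr0.
Qed.

Fact R1_mulDl : left_distributive R1_mul +%R.
Proof.
move=> a b c; apply: R1_eqP => k j; rewrite R1_addE !R1_mulE -big_split.
by apply: eq_bigr => l _; rewrite R1_addE mulrDl.
Qed.

Fact R1_mulDr : right_distributive R1_mul +%R.
Proof.
move=> a b c; apply: R1_eqP => k j; rewrite R1_addE !R1_mulE -big_split.
by apply: eq_bigr => l _; rewrite R1_addE mulrDr.
Qed.

Fact R1_oner_neq0 : R1_one != 0.
Proof.
apply/eqP => /(congr1 (fun a : R1 => a 0%N 0%N)); rewrite R1_oneE /=.
by apply/eqP; rewrite oner_neq0.
Qed.

HB.instance Definition _ := GRing.Zmodule_isNzRing.Build R1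
  R1_mulA R1_mul1 R1_mulr1 R1_mulDl R1_mulDr R1_oner_neq0.

Definition R1_unit : pred R1 := fun a => `[< exists b, b * a = 1 /\ a * b = 1 >].
Definition R1_inv (a : R1) : R1 := xget a [set b | b * a = 1 /\ a * b = 1].

Fact R1_mulVr : {in R1_unit, left_inverse 1 R1_inv *%R}.
Proof. by move=> a /asboolP [b ab]; rewrite /R1_inv; case: xgetP => [c _ []|/(_ b)]. Qed.
Fact R1_divrr : {in R1_unit, right_inverse 1 R1_inv *%R}.
Proof. by move=> a /asboolP [b ab]; rewrite /R1_inv; case: xgetP => [c _ []|/(_ b)]. Qed.
Fact R1_unitP a b : b * a = 1 /\ a * b = 1 -> R1_unit a.
Proof. by move=> ab; apply/asboolP; exists b. Qed.
Fact R1_inv_out : {in [predC R1_unit], R1_inv =1 id}.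
Proof.
by move=> a /asboolPn nu; rewrite /R1_inv; case: xgetP => // b _ ab; case: nu; exists b.
Qed.
HB.instance Definition _ := GRing.NzRing_hasMulInverse.Build R1
  R1_mulVr R1_divrr R1_unitP R1_inv_out.

(* R[i]^o is R[i] with the topology of its norm. *)
Definition R1_cvg (a : nat -> R1) (l : R1) : Prop :=
  forall k j, (fun n => a n k j : R[i]^o) @ \oo --> (l k j : R[i]^o).

Definition Phi (s gamma : nat -> nat -> C) (n : nat) : R1 :=
  lower_part (fun k j => (orthopoly s gamma n j)`_(k - j)).
Definition Phi_sharp (s gamma : nat -> nat -> C) (n : nat) : R1 :=
  lower_part (fun k j => (orthopoly_sharp s gamma n j)`_(k - j)).

End TriangularAlgebra.

Section SpectralFactor.
Variable R : realType.
Local Notation C := R[i].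
Implicit Types (F : nat -> bool) (v : nat -> C) (Theta : R1 R).

(* A family {F_n} of spaces, each {0} or the complex line, is coded by
   F : nat -> bool, with F n = true when F_n is the line. *)

Definition square_summable v : Prop :=
  cvgn (series (fun i => `|v i| ^+ 2 : R[i]^o)).

Definition sqnorm v : C := limn (series (fun i => `|v i| ^+ 2 : R[i]^o)).

(* The Hilbert space sum of the F_i, i >= k. *)
Definition hilbert_sum F (k : nat) : set (nat -> C) :=
  [set v | square_summable v /\ forall i, (i < k)%N || ~~ F i -> v i = 0].

Definition column Theta (j : nat) : nat -> C := fun k => Theta k j.

(* Finite linear combinations of the columns c_j, j >= k, are dense in the
   sum of the F_i, i >= k. *)
Definition columns_total F Theta (k : nat) : Prop :=
  forall v, hilbert_sum F k v -> forall e : C, 0 < e ->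
  exists (N : nat) (x : nat -> C),
    sqnorm (fun i => v i - \sum_(k <= j < N) x j * column Theta j i) < e.

Definition outer_for F Theta : Prop :=
  (forall j, hilbert_sum F j (column Theta j)) /\
  (forall k, columns_total F Theta k).

Definition outer Theta : Prop := exists F, outer_for F Theta.

Definition gram Theta (k j : nat) : C :=
  limn (series (fun i => (column Theta k i)^* * column Theta j i : R[i]^o)).

Definition kernel_le (K1 K2 : nat -> nat -> C) : Prop :=
  forall (n : nat) (x : 'I_n -> C),
    0 <= \sum_(i < n) \sum_(j < n) (x i)^* * (K2 i j - K1 i j) * x j.

Definition is_spectral_factor (K : nat -> nat -> C) Theta : Prop :=
  [/\ outer Theta,
      kernel_le (gram Theta) K,
      forall Theta', outer Theta' -> kernel_le (gram Theta') K ->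
        kernel_le (gram Theta') (gram Theta)
    & forall n, 0 <= Theta n n].

(* Such an array is unique; if there were none, this would be 0, which the
   condition szego_class excludes. *)
Definition spectral_factor (phi : {scalar P2 R}) : R1 R :=
  xget 0 [set Theta | is_spectral_factor (moment_kernel phi) Theta].

Definition szego_class (phi : {scalar P2 R}) : Prop :=
  forall n, 0 < spectral_factor phi n n.

End SpectralFactor.

(* Main.v *)
Require Import Defs.
From HB Require Import structures.
From mathcomp Require Import all_boot all_order all_algebra complex.
From mathcomp Require Import finmap monalg.
From mathcomp Require Import boolp classical_sets functions reals topology.
From mathcomp Require Import normedtype sequences ring.

Set Implicit Arguments.
Unset Strict Implicit.
Unset Printing Implicit Defensive.

Import Order.TTheory GRing.Theory Num.Theory.
Import numFieldNormedType.Exports.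
Local Open Scope ring_scope.

(** Write <p, q> for the sesquilinear form on polynomials with <X^i, X^k> = s_{i,k}
    (kform). Multiplying the polynomials of level l by X^l places all of them in
    this one space. There the X^l phi_n(X, l), for n >= 0, are orthonormal, and
    X^l phi#_n(X, l) is the normalised part of X^l orthogonal to
    X^(l+1), ..., X^(l+n).

    These orthogonality relations have to be extracted from the formula that defines
    the parameters. The product of the rotations of row l carries the first column
    of U_{l+1,l+i} to that of U_{l,l+i}, and rotations are isometric; so these columns
    form a Hilbert space model of the kernel (dotn_dilation). In it multiplication by
    X becomes the action of the rotations of one row (emb_mulX), phi_n becomes the
    n-th coordinate vector, and phi#_n becomes the image of that vector under the
    rotations of row l (emb_orthopolys).

    Let Theta be the spectral factor. The Gram kernel of Theta is below s, so applying
    Theta to coefficient sequences contracts the form into square-summable sequences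
    (tri_apply_le), and column j of Theta Phi_n or of Theta Phi#_n is the image of
    X^j phi_n(X, j) or of X^j phi#_n(X, j). By Bessel's inequality Theta Phi_n tends
    to 0. Column j of Theta Phi#_n has norm at most 1, so it tends to a coordinate
    vector as soon as its diagonal entry Theta_{j,j} b_n tends to 1, where b_n is the
    constant coefficient of phi#_n(X, j). That entry is at most 1. Conversely, by the
    Christoffel-Darboux formula the functionals p |-> <b_n X^j phi#_n, p> have a limit
    (prediction_functional) with value 1 at X^j and 0 at all higher powers. Its norm
    is the limit of b_n, so the functional divided by this norm and put into row j is
    an outer array with Gram kernel below s. The maximality of Theta, together with
    the density of its columns, gives Theta_{j,j} lim b_n >= 1 (outer_diag_le,
    Theta_b_ge1).

    Hence Theta Phi#_n tends to 1. As Theta has positive diagonal it is invertible, and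
    inversion is continuous for entrywise convergence since it proceeds by forward
    substitution (R1_cvg_inv). Therefore Phi_n tends to 0 and the inverse of Phi#_n
    tends to Theta. *)

Local Notation "x %:C" := (real_complex _ x) (at level 1, format "x %:C").

(** * Limits of complex sequences and square-summable sequences *)

Section ComplexSequences.
Local Open Scope classical_set_scope.
Variable R : realType.
Local Notation C := R[i].
Implicit Types (u v a b : nat -> C).

(** Convergence in the norm topology, made opaque once the rules of calculus are
    available: otherwise unification unfolds the topology of the complex field. *)
Definition ccvg u (l : C) : Prop := (u : nat -> C^o) @ \oo --> (l : C^o).
Local Notation "u ~~> l" := (ccvg u l) (at level 70).

Lemma ccvgE u (l : C) : u ~~> l = ((u : nat -> C^o) @ \oo --> (l : C^o)).
Proof. by []. Qed.

Lemma ccvg_cst (c : C) : (fun=> c) ~~> c.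
Proof. exact: cvg_cst. Qed.

Lemma ccvgD u v (l m : C) : u ~~> l -> v ~~> m -> (fun n => u n + v n) ~~> (l + m).
Proof. exact: cvgD. Qed.

Lemma ccvgB u v (l m : C) : u ~~> l -> v ~~> m -> (fun n => u n - v n) ~~> (l - m).
Proof. exact: cvgB. Qed.

Lemma ccvgM u v (l m : C) : u ~~> l -> v ~~> m -> (fun n => u n * v n) ~~> (l * m).
Proof. exact: cvgM. Qed.

Lemma ccvgV u (l : C) : l != 0 -> u ~~> l -> (fun n => (u n)^-1) ~~> l^-1.
Proof. exact: cvgV. Qed.

Lemma ccvg_unique u (l l' : C) : u ~~> l -> u ~~> l' -> l = l'.
Proof. exact: cvg_unique. Qed.

Lemma ccvg_limn u (l : C) : u ~~> l -> limn (u : nat -> C^o) = l.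
Proof. exact: cvg_lim. Qed.

Opaque ccvg.

Lemma ccvg_sum (I : Type) (r : seq I) (P : pred I) (u : I -> nat -> C) (l : I -> C) :
  (forall i, P i -> u i ~~> l i) ->
  (fun n => \sum_(i <- r | P i) u i n) ~~> \sum_(i <- r | P i) l i.
Proof.
move=> ul; elim: r => [|i r IH].
  rewrite big_nil; under eq_fun do rewrite big_nil; exact: ccvg_cst.
rewrite big_cons; under eq_fun do rewrite big_cons.
case Pi: (P i); last exact: IH.
exact: (ccvgD (ul i Pi) IH).
Qed.

Lemma ccvg_shift u (l : C) : u ~~> l -> (fun n => u n.+1) ~~> l.
Proof. by rewrite !ccvgE => H; have := H; rewrite -(cvg_shiftS (u : nat -> C^o)). Qed.

Lemma ccvg_near_cst u (l : C) N : (forall n, (N <= n)%N -> u n = l) -> u ~~> l.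
Proof. by move=> H; rewrite ccvgE; apply: cvg_near_cst; exists N. Qed.

(** Existence of complex limits is reduced to completeness of the real field through
    this embedding: directly for monotone sequences, and by polarization for sums
    of products. *)
Lemma cvg_real_complex (x : nat -> R) (l : R) :
  x @ \oo --> l -> (fun n => (x n)%:C) ~~> l%:C.
Proof.
move=> /cvgrPdist_lt H; apply/cvgrPdist_lt => e e0.
have er : e = (complex.Re e)%:C by rewrite RRe_real // gtr0_real.
have /H : 0 < complex.Re e by rewrite -ltcR -er.
apply: filterS => n; rewrite -ltcR -er; congr (_ < _).
by rewrite -rmorphB normc_def /= expr0n addr0 sqrtr_sqr.
Qed.

(** The partial sums are real and increasing, so their supremum is the limit.
    The last two clauses allow comparison with this limit without any appeal to
    closedness of the order of the complex field. *)
Lemma nneg_series_cvg v (M : C) :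
    (forall i, 0 <= v i) -> (forall n, \sum_(i < n) v i <= M) ->
  exists l : C, [/\ (fun n => \sum_(i < n) v i) ~~> l, forall n, \sum_(i < n) v i <= l
    & forall N, (forall n, \sum_(i < n) v i <= N) -> l <= N].
Proof.
move=> v0 vM; pose x n := complex.Re (\sum_(i < n) v i).
have S0 n : 0 <= \sum_(i < n) v i by apply: sumr_ge0.
have xE n : (x n)%:C = \sum_(i < n) v i by rewrite RRe_real // ger0_real.
have xi : nondecreasing_seq x.
  by apply/nondecreasing_seqP => n; rewrite -lecR !xE big_ord_recr lerDl.
have bnd (N : C) : (forall n, \sum_(i < n) v i <= N) ->
    N = (complex.Re N)%:C /\ forall n, x n <= complex.Re N.
  move=> vN; have N0 : 0 <= N by apply: le_trans (vN 0%N).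
  have NE : N = (complex.Re N)%:C by rewrite RRe_real // ger0_real.
  by split=> // n; rewrite -lecR xE -NE.
have [_ xM] := bnd _ vM.
have ub : has_ubound (range x) by exists (complex.Re M) => _ [n _ <-].
have := nondecreasing_cvgn xi ub.
set l := sup _ => xl; exists l%:C; split.
- by under eq_fun do rewrite -xE; exact: cvg_real_complex.
- by move=> n; rewrite -xE lecR; apply: sup_upper_bound => //; split=> //; exists (x 0%N); exists 0%N.
- move=> N /bnd [-> xN]; rewrite lecR; apply: ge_sup; first by exists (x 0%N); exists 0%N.
  by move=> _ [n _ <-].
Qed.

Lemma square_summableE v (l : C) :
  (fun n => \sum_(i < n) `|v i| ^+ 2) ~~> l -> square_summable v /\ sqnorm v = l.
Proof.
rewrite ccvgE => vl.
have E : series (fun i => `|v i| ^+ 2 : C^o) = (fun n => \sum_(i < n) `|v i| ^+ 2).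
  exact: seriesEord.
split; rewrite ?/square_summable ?/sqnorm E; first exact: (cvgP (l : C^o)).
exact: ccvg_limn.
Qed.

Lemma square_summableP v :
  square_summable v <-> exists M : C, forall n, \sum_(i < n) `|v i| ^+ 2 <= M.
Proof.
split=> [H|[M vM]]; last first.
  have [|l [vl _ _]] := @nneg_series_cvg (fun i => `|v i| ^+ 2) M _ vM.
    by move=> i; rewrite exprn_ge0.
  by have [] := square_summableE vl.
have [M [_ MH]] := cvg_seq_bounded H.
exists (M+1) => n; have := MH (M+1); rewrite ltrDl ltr01 => /(_ isT n I).
by rewrite /= seriesEord /= ger0_norm // sumr_ge0 // => i _; rewrite exprn_ge0.
Qed.

Lemma sqnormP v : square_summable v ->
  [/\ (fun n => \sum_(i < n) `|v i| ^+ 2) ~~> sqnorm v,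
    forall n, \sum_(i < n) `|v i| ^+ 2 <= sqnorm v
    & forall N : C, (forall n, \sum_(i < n) `|v i| ^+ 2 <= N) -> sqnorm v <= N].
Proof.
move=> /square_summableP [M vM].
have [|l [vl ub lub]] := @nneg_series_cvg (fun i => `|v i| ^+ 2) M _ vM.
  by move=> i; rewrite exprn_ge0.
by have [_ ->] := square_summableE vl.
Qed.

Lemma normD_sqr_le (x y : C) : `|x + y| ^+ 2 <= 2 * `|x| ^+ 2 + 2 * `|y| ^+ 2.
Proof.
rewrite -subr_ge0; have -> : 2 * `|x| ^+ 2 + 2 * `|y| ^+ 2 - `|x + y| ^+ 2 = `|x - y| ^+ 2.
  by rewrite !normCK rmorphB rmorphD /=; ring.
by rewrite exprn_ge0.
Qed.

Lemma square_summableD a b : square_summable a -> square_summable b ->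
  square_summable (fun i => a i + b i).
Proof.
move=> /square_summableP [M aM] /square_summableP [N bN]; apply/square_summableP.
exists (2 * M + 2 * N) => n.
apply: (@le_trans _ _ (\sum_(i < n) (2 * `|a i| ^+ 2 + 2 * `|b i| ^+ 2))).
  by apply: ler_sum => i _; apply: normD_sqr_le.
by rewrite big_split -!mulr_sumr lerD // ler_pM2l.
Qed.

Lemma square_summableZ c a : square_summable a -> square_summable (fun i => c * a i).
Proof.
move=> /square_summableP [M aM]; apply/square_summableP.
exists (`|c| ^+ 2 * M) => n; under eq_bigr do rewrite normrM exprMn.
by rewrite -mulr_sumr ler_wpM2l // exprn_ge0.
Qed.

Lemma square_summable_sum (I : Type) (r : seq I) (P : pred I) (F : I -> nat -> C) :
  (forall i, P i -> square_summable (F i)) ->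
  square_summable (fun k => \sum_(i <- r | P i) F i k).
Proof.
move=> H; elim: r => [|i r IH].
  apply/square_summableP; exists 0 => n; rewrite big1 // => k _.
  by rewrite big_nil normr0 expr0n.
have s0 : square_summable (fun k => if P i then F i k else 0).
  case Pi: (P i); first exact: H.
  by apply/square_summableP; exists 0 => n; rewrite big1 // => k _; rewrite normr0 expr0n.
have := square_summableD s0 IH; congr square_summable.
by apply/funext => k; rewrite big_cons; case: ifP; rewrite ?add0r.
Qed.

Lemma polarization (x y : C) : x^* * y = 4^-1 * (`|x + y| ^+ 2 - `|x - y| ^+ 2
  - 'i * (`|x + 'i * y| ^+ 2 - `|x - 'i * y| ^+ 2)).
Proof.
rewrite !normCK !(rmorphB, rmorphD, rmorphM) /= conjCi.
have i2 : ('i : C) * 'i = -1 by rewrite -expr2 sqrCi.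
have n4 : (4 : C) != 0 by rewrite pnatr_eq0.
apply: (mulfI n4); rewrite mulVKf //.
have -> : 4 * (x^* * y) = 2 * (x * y^* + x^* * y) + ('i * 'i) * 2 * (x * y^* - x^* * y).
  by rewrite i2; ring.
ring.
Qed.

(** By polarization the series is a combination of four series of squared norms,
    each of which converges because square-summable sequences form a vector
    space. *)
Lemma square_summable_prod_cvg a b : square_summable a -> square_summable b ->
  exists l, (fun n => \sum_(i < n) (a i)^* * b i) ~~> l.
Proof.
move=> sa sb; have q c : square_summable (fun i => a i + c * b i).
  exact: (square_summableD sa (square_summableZ (c := c) sb)).
have [[q1 _ _] [q2 _ _]] := (sqnormP (q 1), sqnormP (q (-1))).
have [[q3 _ _] [q4 _ _]] := (sqnormP (q 'i), sqnormP (q (- 'i))).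
have := ccvgM (@ccvg_cst 4^-1) (ccvgB (ccvgB q1 q2) (ccvgM (@ccvg_cst 'i) (ccvgB q3 q4))).
set l := (X in _ ~~> X) => H; exists l; move: H; congr ccvg.
apply/funext => n; rewrite -!sumrB mulr_sumr -sumrB mulr_sumr.
by apply: eq_bigr => i _; rewrite polarization !mulNr mul1r.
Qed.

Lemma cvg0_squeeze (v r : nat -> C) :
  (forall n, `|v n| ^+ 2 <= `|r n|) -> r ~~> 0 -> v ~~> 0.
Proof.
move=> vr /cvgrPdist_lt r0; apply/cvgrPdist_lt => e e0.
have /r0 : 0 < e ^+ 2 by rewrite exprn_gt0.
apply: filterS => n; rewrite !sub0r !normrN => re.
by rewrite -ltr_sqr ?nnegrE ?normr_ge0 ?(ltW e0) //; apply: le_lt_trans re.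
Qed.

Lemma norm_lim_le u (l M : C) : u ~~> l -> (forall n, `|u n| <= M) -> `|l| <= M.
Proof.
move=> /cvgrPdist_lt ul uM; apply/ler_addgt0Pr => e /ul [N _ /(_ N (leqnn N)) H].
rewrite -(subrK (u N) l) (le_trans (ler_normD _ _)) // addrC lerD //.
exact: ltW.
Qed.

End ComplexSequences.

Local Notation "u ~~> l" := (ccvg u l) (at level 70).

(** * The sesquilinear form of a kernel on polynomials *)

Section Form.
Variable R : realType.
Local Notation C := R[i].
Implicit Types (s : nat -> nat -> C) (p q r : {poly C}).

(** Polynomials stand for finitely supported sequences of coefficients: X^i is the
    i-th generator, and the form is antilinear in the first argument. *)
Definition kform s p q : C :=
  \sum_(i < size p) \sum_(k < size q) (p`_i)^* * s i k * q`_k.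

Lemma kform_widen s p q N M : (size p <= N)%N -> (size q <= M)%N ->
  kform s p q = \sum_(i < N) \sum_(k < M) (p`_i)^* * s i k * q`_k.
Proof.
move=> pN qM; rewrite /kform.
rewrite (big_ord_widen N (fun i => \sum_(k < size q) (p`_i)^* * s i k * q`_k)) //.
rewrite big_mkcond; apply: eq_bigr => i _; case: ltnP => [_|pi]; last first.
  by rewrite big1 // => k _; rewrite nth_default // conjC0 !mul0r.
rewrite (big_ord_widen M (fun k => (p`_i)^* * s i k * q`_k)) // big_mkcond.
by apply: eq_bigr => k _; case: ltnP => // qk; rewrite [q`_k]nth_default ?mulr0.
Qed.

Lemma kformDr s p q r : kform s p (q + r) = kform s p q + kform s p r.
Proof.
pose M := maxn (size q) (size r).
rewrite !(@kform_widen s p _ (size p) M) ?leq_maxl ?leq_maxr //; last first.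
  exact: size_polyD.
rewrite -big_split; apply: eq_bigr => i _; rewrite -big_split; apply: eq_bigr => k _.
by rewrite coefD mulrDr.
Qed.

Lemma kformZr s c p q : kform s p (c *: q) = c * kform s p q.
Proof.
rewrite !(@kform_widen s p _ (size p) (size q)) ?size_scale_leq //.
rewrite mulr_sumr; apply: eq_bigr => i _; rewrite mulr_sumr; apply: eq_bigr => k _.
by rewrite coefZ; ring.
Qed.

Lemma kformDl s p q r : kform s (p + q) r = kform s p r + kform s q r.
Proof.
pose M := maxn (size p) (size q).
rewrite !(@kform_widen s _ r M (size r)) ?leq_maxl ?leq_maxr //; last first.
  exact: size_polyD.
rewrite -big_split; apply: eq_bigr => i _; rewrite -big_split; apply: eq_bigr => k _.
by rewrite coefD rmorphD !mulrDl.
Qed.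

Lemma kformZl s c p q : kform s (c *: p) q = c^* * kform s p q.
Proof.
rewrite !(@kform_widen s _ q (size p) (size q)) ?size_scale_leq //.
rewrite mulr_sumr; apply: eq_bigr => i _; rewrite mulr_sumr; apply: eq_bigr => k _.
by rewrite coefZ rmorphM; ring.
Qed.

Lemma kform0r s p : kform s p 0 = 0.
Proof. by rewrite -(scale0r 0) kformZr mul0r. Qed.

Lemma kform0l s p : kform s 0 p = 0.
Proof. by rewrite -(scale0r 0) kformZl conjC0 mul0r. Qed.

Lemma kformBr s p q r : kform s p (q - r) = kform s p q - kform s p r.
Proof. by rewrite -scaleN1r kformDr kformZr mulN1r. Qed.

Lemma kformBl s p q r : kform s (p - q) r = kform s p r - kform s q r.
Proof. by rewrite -scaleN1r kformDl kformZl rmorphN1 mulN1r. Qed.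

Lemma kform_sumr s p (I : Type) (r : seq I) (P : pred I) (F : I -> {poly C}) :
  kform s p (\sum_(i <- r | P i) F i) = \sum_(i <- r | P i) kform s p (F i).
Proof. exact: (big_morph (kform s p) (kformDr s p) (kform0r s p)). Qed.

Lemma kform_suml s p (I : Type) (r : seq I) (P : pred I) (F : I -> {poly C}) :
  kform s (\sum_(i <- r | P i) F i) p = \sum_(i <- r | P i) kform s (F i) p.
Proof. exact: (big_morph (kform s ^~ p) (fun a b => kformDl s a b p) (kform0l s p)). Qed.

Lemma kformXn s i k : kform s 'X^i 'X^k = s i k.
Proof.
rewrite /kform !size_polyXn (bigD1 ord_max) //= (bigD1 ord_max) //=.
rewrite !big1 ?addr0 => [|a ai|b bk]; first by rewrite !coefXn !eqxx conjC1 mul1r mulr1.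
  by rewrite big1 // => b _; rewrite coefXn (negbTE (ai : val a != i)) conjC0 !mul0r.
by rewrite [_`_b]coefXn (negbTE (bk : val b != k)) mulr0.
Qed.

Definition positive_kernel s := forall p, p != 0 -> 0 < kform s p p.

Lemma positive_kernel_ge0 s : positive_kernel s -> forall p, 0 <= kform s p p.
Proof.
by move=> H p; have [->|/H/ltW//] := eqVneq p 0; rewrite kform0r.
Qed.

Lemma positive_kernel_diag s : positive_kernel s -> forall i, 0 < s i i.
Proof. by move=> H i; rewrite -kformXn; apply: H; rewrite -size_poly_gt0 size_polyXn. Qed.

(** The shape in which realness of a quadratic form at X^i + c X^k, for c = 1
    and c = i, yields the Hermitian symmetry of the kernel. *)
Lemma hermitian_of_real (x y : C) : x + y \is Num.real -> 'i * (x - y) \is Num.real -> y = x^*.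
Proof.
rewrite !CrealE => /eqP; rewrite rmorphD => E1 /eqP.
rewrite rmorphM rmorphB /= conjCi mulNr -mulrN => /(mulfI (neq0Ci _)).
move=> E2; have n2 : (2 : C) != 0 by rewrite pnatr_eq0.
apply: (mulfI n2); have -> : 2 * y = (x + y) - (x - y) by ring.
by rewrite -E1 -E2; ring.
Qed.

Lemma positive_kernel_herm s : positive_kernel s -> forall i k, s k i = (s i k)^*.
Proof.
move=> H i k; have s0 := positive_kernel_ge0 H.
have rl (x : C) : 0 <= x -> x \is Num.real := @ger0_real _ x.
have di j : s j j \is Num.real by rewrite rl // -kformXn.
have Q (c : C) : `|c| ^+ 2 = 1 -> c * s i k + c^* * s k i \is Num.real.
  move=> c1; have /rl := s0 ('X^i + c *: 'X^k).
  rewrite !(kformDl, kformDr, kformZl, kformZr, kformXn) => H1.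
  have -> : c * s i k + c^* * s k i = - (s i i + s k k) +
    (s i i + c * s i k + (c^* * s k i + c^* * (c * s k k))) - (c * c^* - 1) * s k k by ring.
  by rewrite -normCK c1 subrr mul0r subr0; apply: realD => //; rewrite realN; apply: realD.
apply: hermitian_of_real.
  by have := Q 1; rewrite normr1 expr1n conjC1 !mul1r; apply.
by have := Q 'i; rewrite normCi expr1n conjCi mulrBr mulNr; apply.
Qed.

Lemma kformC s p q : positive_kernel s -> kform s q p = (kform s p q)^*.
Proof.
move=> H; rewrite /kform exchange_big rmorph_sum; apply: eq_bigr => i _.
rewrite rmorph_sum; apply: eq_bigr => k _.
by rewrite !rmorphM /= conjCK (positive_kernel_herm H i k); ring.
Qed.

Lemma kform_cauchy_schwarz s p q : positive_kernel s ->
  `|kform s q p| ^+ 2 <= kform s q q * kform s p p.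
Proof.
move=> H; have [->|q0] := eqVneq q 0; first by rewrite !kform0l normr0 expr0n mul0r.
have N0 := H q q0; rewrite -subr_ge0 normCK -(pmulr_rge0 _ N0).
have Nc : (kform s q q)^* = kform s q q by rewrite -kformC.
(* A multiple of p minus its projection on q, cleared of denominators. *)
have := positive_kernel_ge0 H (kform s q q *: p - kform s q p *: q).
rewrite !(kformBl, kformBr, kformZl, kformZr) Nc (kformC q p H).
by congr (0 <= _); ring.
Qed.

Lemma kernel_le_kform (K1 K2 : nat -> nat -> C) p : kernel_le K1 K2 -> kform K1 p p <= kform K2 p p.
Proof.
move=> H; rewrite -subr_ge0; have := H _ (fun i : 'I_(size p) => p`_i).
congr (0 <= _).
rewrite /kform -sumrB; apply: eq_bigr => i _; rewrite -sumrB; apply: eq_bigr => k _.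
by rewrite mulrBr mulrBl.
Qed.

(** Every finite family of scalars is the coefficient sequence of a polynomial,
    so the ordering of kernels is the pointwise ordering of quadratic forms. *)
Lemma kform_kernel_le (K1 K2 : nat -> nat -> C) :
  (forall p, kform K1 p p <= kform K2 p p) -> kernel_le K1 K2.
Proof.
move=> H n x; pose p := \poly_(i < n) (if insub i is Some i' then x i' else 0).
have := H p; rewrite -subr_ge0; rewrite !(@kform_widen _ p p n n) ?size_poly //.
congr (0 <= _); rewrite -sumrB; apply: eq_bigr => i _; rewrite -sumrB; apply: eq_bigr => k _.
by rewrite !coef_poly !ltn_ord !valK mulrBr mulrBl.
Qed.

End Form.

(** * The form of the moment kernel of a functional *)

Section MomentForm.
Variable R : realType.
Local Notation C := R[i].
Variable phi : {scalar P2 R}.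

Lemma scale_monomial (c : C) (w : {fmonom bool}) : c *: << w >> = << c *g w >>.
Proof. by apply/malgP => v; rewrite mcoeffZ !mcoeffU mulr_natr. Qed.

(** Rewriting J as a map extended additively from monomials makes its additivity
    available. *)
Lemma JE (P : P2 R) : J P = mmap (@malgC {fmonom bool} C \o Num.conj) (fun w => << Jword w >>) P.
Proof.
rewrite /J mmapE; apply: eq_bigr => w _.
by rewrite -scale_monomial /= mul_malgC.
Qed.

Lemma J_sum (I : Type) (r : seq I) (F : I -> P2 R) :
  J (\sum_(i <- r) F i) = \sum_(i <- r) J (F i).
Proof. by rewrite JE raddf_sum; apply: eq_bigr => i _; rewrite JE. Qed.

Lemma JU (c : C) w : J << c *g w >> = << c^* *g Jword w >>.
Proof.
by rewrite JE mmapU /= mul_malgC scale_monomial.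
Qed.

Lemma X1_monomial i : exists w, X1 R ^+ i = << w >>.
Proof.
elim: i => [|i [w IH]]; first by exists mone.
exists (mmul (fmu false) w); rewrite exprS IH /X1 malgM_def.
by rewrite -[fgmul _ _]/(fgmul << 1 *g _ >> << 1 *g _ >>) fgmulUU mulr1.
Qed.

Lemma J_scale_monomial (a b : C) (v w : {fmonom bool}) :
  J (a *: << v >>) * (b *: << w >>) = (a^* * b) *: (J << v >> * << w >>).
Proof.
have U (c d : C) (x y : {fmonom bool}) : << c *g x >> * << d *g y >> = << c * d *g mmul x y >>.
  by rewrite malgM_def fgmulUU.
rewrite (scale_monomial a) (scale_monomial b) (JU a) (JU 1) conjC1 U.
by rewrite U mulr1 scale_monomial.
Qed.

Lemma kform_moment (p : {poly C}) : kform (moment_kernel phi) p p = phi (J (in_X1 p) * in_X1 p).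
Proof.
rewrite /in_X1 J_sum mulr_suml linear_sum; apply: eq_bigr => i _.
rewrite mulr_sumr linear_sum; apply: eq_bigr => k _.
have [[v Ev] [w Ew]] := (X1_monomial i, X1_monomial k).
rewrite /moment_kernel Ev Ew J_scale_monomial linearZ /=.
by rewrite mulrAC.
Qed.

End MomentForm.

(** * The rotations of the parameters as operators on sequences *)

Section Model.
Variable R : realType.
Local Notation C := R[i].
Variable gamma : nat -> nat -> C.
Implicit Types (u v w : nat -> C) (l n m i k : nat).

Definition delta n : nat -> C := fun c => (c == n)%:R.

(** The rotation R_{l,l+p+1} acting on coordinates p and p + 1. Acting on infinite
    sequences lets vectors of all the spaces C^m be compared directly. *)
Definition rot l p w : nat -> C := fun c =>
  if c == p then gamma l (l + p.+1) * w p + defect gamma l (l + p.+1) * w p.+1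
  else if c == p.+1
    then defect gamma l (l + p.+1) * w p - (gamma l (l + p.+1))^* * w p.+1
  else w c.

(** The product R_{l,l+1} ... R_{l,l+n}. *)
Fixpoint rots l n w : nat -> C :=
  if n is n'.+1 then rots l n' (rot l n' w) else w.

(** The first column of U_{l,l+i}, by mxcol_Umx. For fixed l these vectors realise
    the normalised kernel as a Gram matrix, by dotn_dilation. *)
Fixpoint dilation l i : nat -> C :=
  if i is i'.+1 then rots l i (dilation l.+1 i') else delta 0.

Definition dotn N u v : C := \sum_(c < N) (u c)^* * v c.

Lemma rotD l p u v : rot l p (fun c => u c + v c) = fun c => rot l p u c + rot l p v c.
Proof. by apply/funext => c; rewrite /rot; case: eqP => // _; [|case: eqP => // _]; ring. Qed.

Lemma rotZ l p a v : rot l p (fun c => a * v c) = fun c => a * rot l p v c.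
Proof. by apply/funext => c; rewrite /rot; case: eqP => // _; [|case: eqP => // _]; ring. Qed.

Lemma rotsD l n u v : rots l n (fun c => u c + v c) = fun c => rots l n u c + rots l n v c.
Proof. by elim: n u v => //= n IH u v; rewrite rotD IH. Qed.

Lemma rotsZ l n a v : rots l n (fun c => a * v c) = fun c => a * rots l n v c.
Proof. by elim: n v => //= n IH v; rewrite rotZ IH. Qed.

Lemma rots_sum l n N (a : nat -> C) (F : nat -> nat -> C) :
  rots l n (fun c => \sum_(k < N) a k * F k c) = fun c => \sum_(k < N) a k * rots l n (F k) c.
Proof.
elim: N => [|N IH].
  rewrite [X in rots l n X](_ : _ = fun c => 0 * delta 0 c).
    by rewrite rotsZ; apply/funext => c; rewrite big_ord0 mul0r.
  by apply/funext => c; rewrite big_ord0 mul0r.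
under eq_fun do rewrite big_ord_recr /=.
rewrite rotsD IH rotsZ; apply/funext => c; by rewrite big_ord_recr.
Qed.

Lemma rot_id l p w : w p = 0 -> w p.+1 = 0 -> rot l p w = w.
Proof.
move=> w0 w1; apply/funext => c; rewrite /rot w0 w1 !mulr0 subr0 addr0.
by case: eqP => [->|_]; [rewrite w0 | case: eqP => [->|//]; rewrite w1].
Qed.

Lemma rots_above l n w c : (n < c)%N -> rots l n w c = w c.
Proof.
elim: n w => [|n IH] w nc //=; rewrite IH ?(ltnW nc) // /rot.
by rewrite !gtn_eqF // ltnW.
Qed.

(** A rotation of two vanishing coordinates does nothing; hence the number of
    rotations applied to a finitely supported vector may be increased freely,
    which makes the dilation vectors independent of the size of the matrices. *)
Lemma rots_stable l n m w : (forall c, (n <= c)%N -> w c = 0) -> (n <= m)%N ->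
  rots l m w = rots l n w.
Proof.
move=> w0; elim: m => [|m IH]; first by rewrite leqn0 => /eqP ->.
rewrite leq_eqVlt => /orP[/eqP <- //|]; rewrite ltnS => nm /=.
by rewrite rot_id ?IH // w0 // leqW.
Qed.

Lemma rots_low l n w : (forall c, (c <= n)%N -> w c = 0) -> rots l n w = w.
Proof.
elim: n w => [//|n IH] w w0 /=; rewrite rot_id ?w0 //.
by apply: IH => c cn; rewrite w0 // leqW.
Qed.

Lemma dilation_support l i c : (i < c)%N -> dilation l i c = 0.
Proof.
elim: i l => [|i IH] l ic; first by rewrite /= /delta gtn_eqF.
rewrite -[dilation _ _]/(rots l i.+1 (dilation l.+1 i)) rots_above //.
by rewrite IH // ltnW.
Qed.

Lemma dilation_rots l i n : (i < n)%N -> dilation l i.+1 = rots l n (dilation l.+1 i).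
Proof. by move=> ni; rewrite (@rots_stable l i.+1) // => c; apply: dilation_support. Qed.

Hypothesis gamma_lt1 : forall k j, (k < j)%N -> `|gamma k j| < 1.

Lemma defect_gt0 k j : (k < j)%N -> 0 < defect gamma k j.
Proof. by move=> /gamma_lt1 g; rewrite sqrtC_gt0 subr_gt0 exprn_ilt1. Qed.

Lemma defect_sqr k j : defect gamma k j ^+ 2 = 1 - gamma k j * (gamma k j)^*.
Proof. by rewrite sqrtCK normCK. Qed.

(** A rotation is unitary because d^2 = 1 - |gamma|^2 with d real. *)
Lemma dotn_rot N l p u v : (p.+1 < N)%N -> dotn N (rot l p u) (rot l p v) = dotn N u v.
Proof.
move=> pN; rewrite /dotn -!(big_mkord xpredT (fun c => (_ c)^* * _ c)).
have lp : (l < l + p.+1)%N by rewrite addnS ltnS leq_addr.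
have S (F : nat -> C) : \sum_(0 <= c < N) F c =
    \sum_(0 <= c < p) F c + (F p + (F p.+1 + \sum_(p.+2 <= c < N) F c)).
  rewrite (big_cat_nat (leq0n p) (ltnW (ltnW pN))) /=.
  by rewrite (big_ltn (ltnW pN)) (big_ltn pN).
rewrite !S; congr (_ + _).
  by apply: eq_big_nat => c /andP[_ cp]; rewrite /rot !ltn_eqF // ltnW.
rewrite !addrA; congr (_ + _); last first.
  by apply: eq_big_nat => c /andP[cp _]; rewrite /rot !gtn_eqF // ltnW.
rewrite /rot !eqxx !(gtn_eqF (ltnSn p)).
have := defect_sqr l (l + p.+1); have := defect_gt0 lp.
set d := defect _ _ _; set g := gamma _ _ => d0 d2.
have dc : d^* = d by apply: CrealP; rewrite gtr0_real.
rewrite !(rmorphD, rmorphN, rmorphM) /= conjCK dc.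
transitivity ((d ^+ 2 + g * g^*) * ((u p)^* * v p + (u p.+1)^* * v p.+1)); first by ring.
by rewrite d2; ring.
Qed.

Lemma dotn_rots N l n u v : (n < N)%N -> dotn N (rots l n u) (rots l n v) = dotn N u v.
Proof.
elim: n u v => //= n IH u v nN; rewrite IH ?dotn_rot //; exact: ltnW.
Qed.

Lemma dotn_delta N n v : (n < N)%N -> dotn N (delta n) v = v n.
Proof.
move=> nN; rewrite /dotn (bigD1 (Ordinal nN)) //= big1 => [|c cn].
  by rewrite /delta eqxx conjC1 mul1r addr0.
by rewrite /delta (negbTE (cn : val c != n)) conjC0 mul0r.
Qed.

(** Both vectors are images under the same rotations of vectors at level l + 1,
    and rotations are isometric; after i steps the left one is delta 0, whose
    product with a vector is the coordinate at 0. *)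
Lemma dotn_dilation N l i k : (i <= k < N)%N ->
  dotn N (dilation l i) (dilation l k) = dilation (l + i) (k - i) 0%N.
Proof.
elim: i l k => [|i IH] l k /andP[ik kN].
  by rewrite addn0 subn0 dotn_delta // (leq_ltn_trans _ kN).
case: k ik kN => // k ik kN; rewrite !(@dilation_rots l _ k.+1) // dotn_rots //.
by rewrite IH ?addSnnS ?subSS // (ltnW kN) andbT.
Qed.

Section Matrix.

(** A column extended by zeros, so that matrices of different sizes are compared
    as sequences. *)
Definition mxcol N q (M : 'M[C]_(N, q)) j : nat -> C :=
  fun c => if insub c is Some c' then M c' j else 0.

Lemma mxcolE N q (M : 'M[C]_(N, q)) j (c : 'I_N) : mxcol M j c = M c j.
Proof. by rewrite /mxcol valK. Qed.

Lemma mxcol_rotation N q (M : 'M[C]_(N, q)) j k p : (p.+1 < N)%N ->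
  mxcol (rotation gamma k N p *m M) j = rot k p (mxcol M j).
Proof.
move=> pN; have pN' := ltnW pN; apply/funext => c.
pose P := Ordinal pN'; pose P1 := Ordinal pN.
have EP : mxcol M j p = M P j := mxcolE M j P.
have EP1 : mxcol M j p.+1 = M P1 j := mxcolE M j P1.
rewrite {1}/mxcol; case: insubP => [c' _ <-|]; last first.
  rewrite -leqNgt => Nc; rewrite /rot !gtn_eqF ?(leq_trans _ Nc) //.
  by rewrite /mxcol insubN // -leqNgt.
rewrite mxE (bigD1 P) //= (bigD1 P1) //=; last by rewrite -val_eqE /= gtn_eqF.
rewrite addrA !mxE /= /rot EP EP1 mxcolE !eqxx (gtn_eqF (ltnSn p)) (ltn_eqF (ltnSn p)) !andbF !andbT.
case: (eqVneq (val c') p) => [c'p|c'p].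
  rewrite big1 ?addr0 ?c'p ?(ltn_eqF (ltnSn p)) // => b /andP[bp bp1].
  rewrite mxE c'p eqxx /= (negbTE (bp : val b != p)) (negbTE (bp1 : val b != p.+1)).
  rewrite (ltn_eqF (ltnSn p)) /= (_ : (c' == b) = false) ?mul0r //.
  by rewrite -val_eqE c'p eq_sym; apply/negbTE.
case: (eqVneq (val c') p.+1) => [c'p1|c'p1].
  rewrite big1 ?addr0 ?mulNr // => b /andP[bp bp1].
  rewrite mxE c'p1 eqxx (gtn_eqF (ltnSn p)) /= (negbTE (bp : val b != p)) (negbTE (bp1 : val b != p.+1)).
  rewrite (_ : (c' == b) = false) ?mul0r //.
  by rewrite -val_eqE c'p1 eq_sym; apply/negbTE.
rewrite -!val_eqE /= (negbTE c'p) (negbTE c'p1) !mul0r add0r add0r (bigD1 c') /=; last first.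
  by rewrite -!val_eqE /= c'p c'p1.
rewrite mxE (negbTE c'p) (negbTE c'p1) eqxx mul1r big1 ?addr0 // => b /andP[_ bc'].
by rewrite mxE (negbTE c'p) (negbTE c'p1) /= [c' == b]eq_sym (negbTE bc') mul0r.
Qed.

Lemma mxcol_rotations N q (M : 'M[C]_(N.+1, q)) j k m : (m < N.+1)%N ->
  mxcol ((\prod_(p < m) rotation gamma k N.+1 p) *m M) j = rots k m (mxcol M j).
Proof.
elim: m M => [|m IH] M mN; first by rewrite big_ord0 mul1mx.
by rewrite big_ord_recr /= -mulmxE -mulmxA IH ?mxcol_rotation // ltnW.
Qed.

Lemma mxcol_Umx k n : mxcol (Umx gamma k n) ord0 = dilation k n.
Proof.
elim: n k => [|n IH] k.
  apply/funext => c; rewrite /mxcol /= /delta; case: insubP => [c' _ <-|].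
    by rewrite mxE -val_eqE.
  by rewrite -leqNgt; case: c.
rewrite [Umx _ _ _]/= mxcol_rotations //.
rewrite -[dilation k n.+1]/(rots k n.+1 (dilation k.+1 n)); congr rots.
rewrite -IH; apply/funext => c; rewrite /mxcol.
case: insubP => [c' cn cc'|]; last first.
  by rewrite -leqNgt => nc; rewrite insubN // -leqNgt ltnW.
rewrite castmxE /=.
have -> : cast_ord (esym (addn1 n.+1)) ord0 = lshift 1 (ord0 : 'I_n.+1) by apply/val_inj.
case: insubP => [c2 cn2 cc2|].
  have -> : cast_ord (esym (addn1 n.+1)) c' = lshift 1 c2 by apply/val_inj; rewrite /= cc2.
  by rewrite block_mxEul.
rewrite -leqNgt => nc.
have -> : cast_ord (esym (addn1 n.+1)) c' = rshift n.+1 (ord0 : 'I_1).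
  by apply/val_inj; rewrite /= addn0 cc'; apply/eqP; rewrite eqn_leq nc andbT -ltnS.
by rewrite block_mxEdl mxE.
Qed.

Lemma Umx00 k n : Umx gamma k n ord0 ord0 = dilation k n 0%N.
Proof. by rewrite -mxcol_Umx -[RHS]/(mxcol _ _ (val (ord0 : 'I_n.+1))) mxcolE. Qed.

End Matrix.
End Model.

(** * Orthonormality of the polynomials *)

Section Orthonormality.
Variable R : realType.
Local Notation C := R[i].
Variables (s gamma : nat -> nat -> C).
Hypothesis s_pos : positive_kernel s.
Hypothesis s_gamma : is_parameters s gamma.
Implicit Types (l n m i k : nat) (p q : {poly C}).

Let gamma_lt1 : forall k j, (k < j)%N -> `|gamma k j| < 1 := s_gamma.1.

Lemma kform_shift l p q : kform s ('X^l * p) ('X^l * q) =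
  \sum_(i < size p) \sum_(k < size q) (p`_i)^* * s (l + i)%N (l + k)%N * q`_k.
Proof.
have E (r : {poly C}) : 'X^l * r = \sum_(i < size r) r`_i *: 'X^(l + i).
  rewrite -{1}[r]coefK poly_def mulr_sumr; apply: eq_bigr => i _.
  by rewrite -scalerAr -exprD.
rewrite !E kform_suml; apply: eq_bigr => i _; rewrite kform_sumr; apply: eq_bigr => k _.
by rewrite kformZl kformZr kformXn; ring.
Qed.

(** The isometry that realises the form at level l in the space of sequences: it
    sends X^k to the normalised dilation vector. *)
Definition emb l p : nat -> C := fun c =>
  \sum_(k < size p) p`_k * (sqrtC (s (l + k)%N (l + k)%N) * dilation gamma l k c).

Lemma emb_widen l p N : (size p <= N)%N -> emb l p = fun c =>
  \sum_(k < N) p`_k * (sqrtC (s (l + k)%N (l + k)%N) * dilation gamma l k c).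
Proof.
move=> pN; apply/funext => c; rewrite /emb.
pose F k := p`_k * (sqrtC (s (l + k)%N (l + k)%N) * dilation gamma l k c).
rewrite (big_ord_widen N F) // big_mkcond; apply: eq_bigr => k _.
by case: ltnP => // pk; rewrite nth_default ?mul0r.
Qed.

Lemma embD l p q : emb l (p + q) = fun c => emb l p c + emb l q c.
Proof.
rewrite (emb_widen l (size_polyD p q)) (emb_widen l (leq_maxl (size p) (size q))).
rewrite (emb_widen l (leq_maxr (size p) (size q))); apply/funext => c.
by rewrite -big_split; apply: eq_bigr => k _; rewrite coefD mulrDl.
Qed.

Lemma embZ l a p : emb l (a *: p) = fun c => a * emb l p c.
Proof.
rewrite (emb_widen l (size_scale_leq a p)); apply/funext => c.
by rewrite mulr_sumr; apply: eq_bigr => k _; rewrite coefZ mulrA.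
Qed.

(** Multiplication by X shifts the level by one, which in the model is the action
    of the rotations of row l. *)
Lemma emb_mulX l p n : (size p <= n)%N -> emb l ('X * p) = rots gamma l n (emb l.+1 p).
Proof.
move=> pn; have Xn : (size ('X * p)%R <= n.+1)%N.
  by rewrite (leq_trans (size_polyMleq _ _)) // size_polyX.
pose F k : nat -> C := fun c =>
  sqrtC (s (l.+1 + k)%N (l.+1 + k)%N) * dilation gamma l.+1 k c.
rewrite (emb_widen l Xn) (emb_widen l.+1 pn).
rewrite -[fun c => _ in RHS]/(fun c => \sum_(k < n) p`_k * F k c).
rewrite rots_sum; apply/funext => c.
rewrite big_ord_recl coefXM mul0r add0r; apply: eq_bigr => k _.
by rewrite coefXM /= rotsZ -dilation_rots // addSnnS.
Qed.

Lemma emb_support l p c : (size p <= c)%N -> emb l p c = 0.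
Proof.
move=> pc; rewrite /emb big1 // => k _.
by rewrite dilation_support ?mulr0 // (leq_trans _ pc).
Qed.

(** The defining formula of the parameters, extended to all pairs of indices by
    Hermitian symmetry. *)
Lemma dotn_dilation_kernel N l i k : (i < N)%N -> (k < N)%N ->
  sqrtC (s (l + i)%N (l + i)%N) * sqrtC (s (l + k)%N (l + k)%N) *
    dotn N (dilation gamma l i) (dilation gamma l k) = s (l + i)%N (l + k)%N.
Proof.
have sr j : (sqrtC (s j j))^* = sqrtC (s j j).
  by apply: CrealP; rewrite ger0_real // sqrtC_ge0 ltW // positive_kernel_diag.
wlog ik : i k / (i <= k)%N.
  move=> H iN kN; case/orP: (leq_total i k) => [ik|ki]; first exact: H.
  rewrite (positive_kernel_herm s_pos (l + k) (l + i)) -(H k i) // !rmorphM /= !sr.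
  rewrite [sqrtC (s (l + i)%N _) * _]mulrC; congr (_ * _ * _); rewrite /dotn rmorph_sum.
  by apply: eq_bigr => c _; rewrite rmorphM /= conjCK mulrC.
move=> iN kN; rewrite dotn_dilation ?ik //.
move: ik; rewrite leq_eqVlt => /orP[/eqP->|ik].
  by rewrite subnn /= /delta eqxx mulr1 -expr2 sqrtCK.
rewrite [RHS]s_gamma.2 ?ltn_add2l // Umx00 subnDl; ring.
Qed.

Lemma kform_emb N l p q : (size p <= N)%N -> (size q <= N)%N ->
  kform s ('X^l * p) ('X^l * q) = dotn N (emb l p) (emb l q).
Proof.
move=> pN qN; rewrite kform_shift.
have sr j : (sqrtC (s j j))^* = sqrtC (s j j).
  by apply: CrealP; rewrite ger0_real // sqrtC_ge0 ltW // positive_kernel_diag.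
transitivity (\sum_(i < size p) \sum_(k < size q) \sum_(c < N)
   (p`_i * (sqrtC (s (l + i)%N (l + i)%N) * dilation gamma l i c))^* *
   (q`_k * (sqrtC (s (l + k)%N (l + k)%N) * dilation gamma l k c))).
  apply: eq_bigr => i _; apply: eq_bigr => k _.
  rewrite -(@dotn_dilation_kernel N l i k) ?(leq_trans (ltn_ord _)) //.
  rewrite mulr_sumr mulr_sumr mulr_suml; apply: eq_bigr => c _.
  by rewrite !rmorphM /= sr; ring.
rewrite /dotn.
under eq_bigr do rewrite exchange_big /=.
rewrite exchange_big; apply: eq_bigr => c _.
by rewrite rmorph_sum mulr_suml; apply: eq_bigr => i _; rewrite mulr_sumr.
Qed.

Lemma orthopolyS n l : orthopoly s gamma n.+1 l =
  (defect gamma l (n.+1 + l))^-1 *: ('X * orthopoly s gamma n l.+1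
     - gamma l (n.+1 + l)%N *: orthopoly_sharp s gamma n l).
Proof. by []. Qed.

Lemma orthopoly_sharpS n l : orthopoly_sharp s gamma n.+1 l =
  (defect gamma l (n.+1 + l))^-1 *: (- (gamma l (n.+1 + l)%N)^* *: ('X * orthopoly s gamma n l.+1)
     + orthopoly_sharp s gamma n l).
Proof. by []. Qed.

Lemma size_orthopolys n l : (size (orthopoly s gamma n l) <= n.+1)%N /\
  (size (orthopoly_sharp s gamma n l) <= n.+1)%N.
Proof.
elim: n l => [|n IH] l; first by split; apply: size_polyC_leq1.
have XP : (size ('X * orthopoly s gamma n l.+1)%R <= n.+2)%N.
  by rewrite (leq_trans (size_polyMleq _ _)) // size_polyX /= ltnS (IH l.+1).1.
have Q := leq_trans (IH l).2 (leqnSn _).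
rewrite orthopolyS orthopoly_sharpS; split.
  rewrite (leq_trans (size_scale_leq _ _)) // (leq_trans (size_polyD _ _)) //.
  by rewrite geq_max XP size_polyN (leq_trans (size_scale_leq _ _)).
rewrite (leq_trans (size_scale_leq _ _)) // (leq_trans (size_polyD _ _)) //.
by rewrite geq_max Q (leq_trans (size_scale_leq _ _)).
Qed.

(** The recursion of the polynomials is the action of one rotation. Writing A for
    the image of X phi_n(X, l+1) and B for that of phi#_n(X, l), the rotation of
    coordinates n and n + 1 gives A = gamma B + d delta_(n+1), and solving for
    delta_(n+1) is the recursion of phi_(n+1). *)
Lemma emb_orthopolys n l : emb l (orthopoly s gamma n l) = delta R n /\
  emb l (orthopoly_sharp s gamma n l) = rots gamma l n (delta R n).
Proof.
elim: n l => [|n IH] l.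
  suff E : emb l ((sqrtC (s l l))^-1)%:P = delta R 0 by split.
  apply/funext => c; rewrite (emb_widen l (size_polyC_leq1 _)) big_ord1 coefC /=.
  rewrite addn0 mulrA mulVf ?mul1r // sqrtC_eq0 gt_eqF //.
  exact: positive_kernel_diag.
have [_ IHs] := IH l; have [IHp _] := IH l.+1.
rewrite orthopolyS orthopoly_sharpS [(n.+1 + l)%N]addnC.
have ll : (l < l + n.+1)%N by rewrite addnS ltnS leq_addr.
have := defect_gt0 gamma_lt1 ll; have d2 := defect_sqr gamma l (l + n.+1).
set d := defect _ _ _ in d2 *; set g := gamma _ _ in d2 * => d0.
have r1 : rot gamma l n (delta R n) = fun c => g * delta R n c + d * delta R n.+1 c.
  apply/funext => c; rewrite /rot /delta -/g -/d.
  have [->|cn] := eqVneq c n; last have [_|cn1] := eqVneq c n.+1.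
  - rewrite ?(eqxx, gtn_eqF (ltnSn n), ltn_eqF (ltnSn n)) /=; ring.
  - rewrite ?(eqxx, gtn_eqF (ltnSn n), ltn_eqF (ltnSn n)) /=; ring.
  - by rewrite !mulr0 addr0.
have r2 : rot gamma l n (delta R n.+1) = fun c => d * delta R n c + - g^* * delta R n.+1 c.
  apply/funext => c; rewrite /rot /delta -/g -/d.
  have [->|cn] := eqVneq c n; last have [_|cn1] := eqVneq c n.+1.
  - rewrite ?(eqxx, gtn_eqF (ltnSn n), ltn_eqF (ltnSn n)) /=; ring.
  - rewrite ?(eqxx, gtn_eqF (ltnSn n), ltn_eqF (ltnSn n)) /=; ring.
  - by rewrite !mulr0 addr0.
have low : rots gamma l n (delta R n.+1) = delta R n.+1.
  by apply: rots_low => c cn; rewrite /delta ltn_eqF.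
have A : emb l ('X * orthopoly s gamma n l.+1) =
    fun c => g * rots gamma l n (delta R n) c + d * delta R n.+1 c.
  by rewrite (emb_mulX l (size_orthopolys n l.+1).1) IHp /= r1 rotsD !rotsZ low.
have dn : d != 0 by rewrite gt_eqF.
rewrite -[- (g *: _)]scaleN1r !(embZ, embD) A IHs; split; apply/funext => c.
  by apply: (mulfI dn); rewrite mulVKf //; ring.
rewrite /= r2 rotsD !rotsZ low.
apply: (mulfI dn); rewrite mulVKf // [RHS]mulrDr [d * (d * _)]mulrA -expr2 d2; ring.
Qed.

Lemma kform_orthopoly l n m :
  kform s ('X^l * orthopoly s gamma n l) ('X^l * orthopoly s gamma m l) = (n == m)%:R.
Proof.
pose N := (maxn n m).+1.
rewrite (@kform_emb N) ?(leq_trans (size_orthopolys _ _).1) ?ltnS ?leq_maxl ?leq_maxr //.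
rewrite !(emb_orthopolys _ _).1 dotn_delta ?ltnS ?leq_maxl //.
Qed.

Lemma kform_orthopoly_sharp l n :
  kform s ('X^l * orthopoly_sharp s gamma n l) ('X^l * orthopoly_sharp s gamma n l) = 1.
Proof.
rewrite (@kform_emb n.+1) ?(size_orthopolys _ _).2 //.
by rewrite !(emb_orthopolys _ _).2 dotn_rots // dotn_delta // /delta eqxx.
Qed.

(** For i > l, X^i is the image under the rotations of row l of a vector supported
    below n, whereas phi#_n is the image of delta n. *)
Lemma kform_orthopoly_sharp_Xn l n i : (l < i <= l + n)%N ->
  kform s ('X^l * orthopoly_sharp s gamma n l) 'X^i = 0.
Proof.
move=> /andP[li iln]; have E : 'X^i = 'X^l * ('X * 'X^(i - l.+1)) :> {poly C}.
  by rewrite -exprS -exprD subnSK // subnKC // ltnW.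
have sz : (size ('X^(i - l.+1) : {poly C}) <= n)%N.
  by rewrite size_polyXn subnSK // leq_subLR.
rewrite E (@kform_emb n.+1) ?(size_orthopolys _ _).2 //; last first.
  by rewrite (leq_trans (size_polyMleq _ _)) // size_polyX.
rewrite (emb_orthopolys _ _).2 (emb_mulX l sz) dotn_rots // dotn_delta //.
exact: emb_support.
Qed.

End Orthonormality.

(** * Inverses and limits of lower triangular arrays *)

Section TriangularInverse.
Variable R : realType.
Local Notation C := R[i].
Implicit Types (a b c : R1 R) (k j l n : nat).

Lemma R1_cvgE (a : nat -> R1 R) b : R1_cvg a b <-> forall k j, (fun n => a n k j) ~~> b k j.
Proof. by split=> H k j; have := H k j; rewrite ccvgE. Qed.

Lemma R1_mul_entry a b k j : (a * b) k j = \sum_(l < k.+1) a k l * b l j.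
Proof. exact: R1_mulE. Qed.

Lemma R1_one_entry k j : (1 : R1 R) k j = (k == j)%:R.
Proof. exact: R1_oneE. Qed.

Lemma R1_zero_entry k j : (0 : R1 R) k j = 0.
Proof. by rewrite -[R1_entry 0]/(val (0 : R1 R)) raddf0. Qed.

Lemma R1_mul_diag a b k : (a * b) k k = a k k * b k k.
Proof.
rewrite R1_mul_entry big_ord_recr /= big1 ?add0r // => l _.
by rewrite (R1_lower b) ?mulr0.
Qed.

(** Row k of the equation a x = 1, solved for the last unknown. *)
Lemma R1_solve a k j (x : R1 R) : a k k != 0 -> a * x = 1 ->
  x k j = (a k k)^-1 * ((k == j)%:R - \sum_(l < k) a k l * x l j).
Proof.
move=> ak ax; apply: (mulfI ak); rewrite mulVKf // -R1_one_entry -ax R1_mul_entry.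
by rewrite big_ord_recr /= addrC addrK.
Qed.

Section RightInverse.
Variable a : R1 R.

(** The first argument bounds the depth of recursion: row k is correct as soon as
    n exceeds k, by forward_substitution_stable. *)
Fixpoint forward_substitution n k j : C :=
  if n is n'.+1 then
    (a k k)^-1 * ((k == j)%:R - \sum_(l < k) a k l * forward_substitution n' l j)
  else 0.

Lemma forward_substitution_stable n m k j : (k < n)%N -> (k < m)%N ->
  forward_substitution n k j = forward_substitution m k j.
Proof.
elim: n m k => [//|n IH] [//|m] k kn km /=; congr (_ * (_ - _)).
by apply: eq_bigr => l _; rewrite (IH m) ?(leq_trans (ltn_ord l)).
Qed.

Lemma forward_substitution_lower n k j : (k < j)%N -> forward_substitution n k j = 0.
Proof.
elim: n k => [//|n IH] k kj /=; rewrite (ltn_eqF kj) big1 ?subr0 ?mulr0 // => l _.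
by rewrite IH ?mulr0 // (ltn_trans _ kj).
Qed.

Lemma R1_right_inverse : (forall k, a k k != 0) -> exists b, a * b = 1.
Proof.
move=> a0; exists (lower_part (fun k j => forward_substitution k.+1 k j)).
have bE k j : lower_part (fun k j => forward_substitution k.+1 k j) k j =
    forward_substitution k.+1 k j.
  rewrite [LHS]/=; case: ifP => // kj.
  by rewrite -[RHS]/(forward_substitution k.+1 k j) forward_substitution_lower.
apply: R1_eqP => k j; rewrite R1_mul_entry R1_one_entry.
under eq_bigr do rewrite bE.
pose f l := a k l * forward_substitution l.+1 l j.
rewrite (big_ord_recr k f) /= [f k]/f [forward_substitution k.+1 k j]/= mulVKf // addrC.
rewrite (eq_bigr (fun l : 'I_k => f l)) ?subrK // => l _.
by congr (_ * _); apply: forward_substitution_stable.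
Qed.

End RightInverse.

(** A right inverse again has nonzero diagonal, so it has a right inverse itself,
    which must be the original array. *)
Lemma R1_unit_diag a : (forall k, a k k != 0) -> a \is a GRing.unit.
Proof.
move=> a0; have [b ab] := R1_right_inverse a0.
have b0 k : b k k != 0.
  have E : a k k * b k k = 1 by rewrite -R1_mul_diag ab R1_one_entry eqxx.
  by apply: contra_eq_neq E => ->; rewrite mulr0 eq_sym oner_neq0.
have [c bc] := R1_right_inverse b0.
by apply/unitrP; exists b; split=> //; rewrite -[a]mulr1 -bc (mulrA a) ab mul1r.
Qed.

Lemma R1_cvg_mul (a b : nat -> R1 R) (l m : R1 R) :
  R1_cvg a l -> R1_cvg b m -> R1_cvg (fun n => a n * b n) (l * m).
Proof.
move=> /R1_cvgE al /R1_cvgE bm; apply/R1_cvgE => k j; rewrite R1_mul_entry.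
under eq_fun do rewrite R1_mul_entry.
by apply: ccvg_sum => i _; apply: ccvgM.
Qed.

Lemma R1_cvg_cst (l : R1 R) : R1_cvg (fun=> l) l.
Proof. by apply/R1_cvgE => k j; apply: ccvg_cst. Qed.

(** Row k of an inverse is a continuous expression in the array and in the earlier
    rows of the inverse. *)
Lemma R1_cvg_inv (a : nat -> R1 R) (l : R1 R) :
  (forall n k, a n k k != 0) -> (forall k, l k k != 0) ->
  R1_cvg a l -> R1_cvg (fun n => (a n)^-1) l^-1.
Proof.
move=> a0 l0 /R1_cvgE al; apply/R1_cvgE => k j.
elim/ltn_ind: k => k IH.
have inv c : (forall k, c k k != 0) -> c * c^-1 = 1.
  by move=> /R1_unit_diag; apply: mulrV.
rewrite (R1_solve j (l0 k) (inv l l0)).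
under eq_fun do rewrite (R1_solve j (a0 _ k) (inv _ (a0 _))).
apply: ccvgM; first exact: ccvgV.
apply: ccvgB; first exact: ccvg_cst.
by apply: ccvg_sum => i _; apply: ccvgM => //; apply: IH.
Qed.

End TriangularInverse.

(** * Arrays acting on polynomials and Bessel's inequality *)

Section RowAction.
Variable R : realType.
Local Notation C := R[i].
Implicit Types (p q : {poly C}) (Theta : R1 R).

Definition tri_apply Theta p : nat -> C := fun k => \sum_(i < k.+1) Theta k i * p`_i.

Lemma tri_applyE Theta p k N : (size p <= N)%N ->
  tri_apply Theta p k = \sum_(i < N) Theta k i * p`_i.
Proof.
move=> pN; pose F i := Theta k i * p`_i.
rewrite /tri_apply (big_ord_widen (k.+1 + N) F) ?leq_addr //.
rewrite [RHS](big_ord_widen (k.+1 + N) F) ?leq_addl //.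
rewrite big_mkcond [RHS]big_mkcond; apply: eq_bigr => i _.
case: ltnP => [_|ki]; case: ltnP => // Ni; rewrite /F.
  by rewrite nth_default ?mulr0 // (leq_trans pN).
by rewrite R1_lower ?mul0r.
Qed.

Lemma tri_applyD Theta p q k :
  tri_apply Theta (p + q) k = tri_apply Theta p k + tri_apply Theta q k.
Proof. by rewrite /tri_apply -big_split; apply: eq_bigr => i _; rewrite coefD mulrDr. Qed.

Lemma tri_applyZ Theta c p k : tri_apply Theta (c *: p) k = c * tri_apply Theta p k.
Proof. by rewrite /tri_apply mulr_sumr; apply: eq_bigr => i _; rewrite coefZ; ring. Qed.

Lemma tri_apply_Xn Theta i k : tri_apply Theta 'X^i k = Theta k i.
Proof.
rewrite (@tri_applyE _ _ _ i.+1) ?size_polyXn // big_ord_recr /= big1 ?add0r.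
  by rewrite coefXn eqxx mulr1.
by move=> l _; rewrite coefXn (ltn_eqF (ltn_ord l)) mulr0.
Qed.

Lemma tri_apply0 Theta k : tri_apply Theta 0 k = 0.
Proof. by rewrite /tri_apply big1 // => i _; rewrite coef0 mulr0. Qed.

Lemma tri_apply_sum Theta (I : Type) (r : seq I) (P : pred I) (F : I -> {poly C}) k :
  tri_apply Theta (\sum_(i <- r | P i) F i) k = \sum_(i <- r | P i) tri_apply Theta (F i) k.
Proof.
exact: (big_morph (tri_apply Theta ^~ k) (fun p q => tri_applyD Theta p q k) (tri_apply0 Theta k)).
Qed.

Lemma gram_cvg Theta i k : square_summable (column Theta i) -> square_summable (column Theta k) ->
  (fun n => \sum_(r < n) (Theta r i)^* * Theta r k) ~~> gram Theta i k.
Proof.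
move=> si sk; have [l H] := square_summable_prod_cvg si sk.
suff -> : gram Theta i k = l by [].
have E : series (fun r => (column Theta i r)^* * column Theta k r : C^o) =
    (fun n => \sum_(r < n) (Theta r i)^* * Theta r k) by exact: seriesEord.
by rewrite /gram E; apply: ccvg_limn.
Qed.

(** Expanding the squares of the coordinates of Theta p gives, up to row n, partial
    sums of the entries of the Gram kernel. *)
Lemma kform_gram Theta p : (forall j, square_summable (column Theta j)) ->
  square_summable (tri_apply Theta p) /\ sqnorm (tri_apply Theta p) = kform (gram Theta) p p.
Proof.
move=> sc; apply: square_summableE.
have -> : (fun n => \sum_(r < n) `|tri_apply Theta p r| ^+ 2) = (fun n =>
   \sum_(i < size p) \sum_(k < size p) ((p`_i)^* * \sum_(r < n) (Theta r i)^* * Theta r k) * p`_k).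
  apply/funext => n.
  transitivity (\sum_(r < n) \sum_(i < size p) \sum_(k < size p)
      (p`_i)^* * ((Theta r i)^* * Theta r k) * p`_k).
    apply: eq_bigr => r _; rewrite (tri_applyE _ _ (leqnn _)) normCK mulrC rmorph_sum mulr_suml.
    apply: eq_bigr => i _; rewrite mulr_sumr; apply: eq_bigr => k _.
    by rewrite rmorphM; ring.
  rewrite exchange_big; apply: eq_bigr => i _; rewrite exchange_big; apply: eq_bigr => k _.
  by rewrite mulr_sumr mulr_suml.
rewrite /kform; apply: ccvg_sum => i _; apply: ccvg_sum => k _.
apply: ccvgM; last exact: ccvg_cst.
by apply: ccvgM; [exact: ccvg_cst | exact: gram_cvg].
Qed.

(** When the Gram kernel of Theta is below K, the map p |-> Theta p is a
    contraction from the form of K to square-summable sequences. *)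
Lemma tri_apply_le (K : nat -> nat -> C) Theta p n : (forall j, square_summable (column Theta j)) ->
  kernel_le (gram Theta) K -> \sum_(r < n) `|tri_apply Theta p r| ^+ 2 <= kform K p p.
Proof.
move=> sc le; have [sq E] := kform_gram p sc.
have [_ ub _] := sqnormP sq; apply: le_trans (ub n) _.
by rewrite E; apply: kernel_le_kform.
Qed.

(** Test the bound of the functional on x = sum_k conj(lam g_k) g_k. Both lam x and
    the form at x equal the sum S in question, so S^2 <= M S. *)
Lemma bessel (s : nat -> nat -> C) (lam : {poly C} -> C) (M : C) (g : nat -> {poly C}) n :
    (forall p q, lam (p + q) = lam p + lam q) -> (forall c p, lam (c *: p) = c * lam p) ->
    0 <= M -> (forall p, `|lam p| ^+ 2 <= M * kform s p p) ->
    (forall i k, kform s (g i) (g k) = (i == k)%:R) ->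
  \sum_(k < n) `|lam (g k)| ^+ 2 <= M.
Proof.
move=> lD lZ M0 lM on; set S := \sum_(k < n) _.
have S0 : 0 <= S by apply: sumr_ge0 => k _; rewrite exprn_ge0.
have l0 : lam 0 = 0 by rewrite -(scale0r 0) lZ mul0r.
pose x := \sum_(k < n) (lam (g k))^* *: g k.
have lx : lam x = S.
  rewrite (big_morph lam lD l0); apply: eq_bigr => k _.
  by rewrite lZ normCK mulrC.
have xx : kform s x x = S.
  rewrite kform_suml; apply: eq_bigr => i _; rewrite kform_sumr (bigD1 i) //=.
  rewrite big1 ?addr0 => [|k ki].
    by rewrite kformZl kformZr on eqxx conjCK mulr1 normCK.
  by rewrite kformZl kformZr on eq_sym (negbTE (ki : val k != val i)) !mulr0.
have := lM x; rewrite lx xx ger0_norm // => SS.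
have [->//|Sn] := eqVneq S 0.
by rewrite -(ler_pM2r (_ : 0 < S)) -?expr2 // lt_def Sn.
Qed.

End RowAction.

(** * Constant coefficients and the Christoffel-Darboux formula *)

Section ChristoffelDarboux.
Variable R : realType.
Local Notation C := R[i].
Variables (s gamma : nat -> nat -> C).
Hypothesis s_pos : positive_kernel s.
Hypothesis gamma_lt1 : forall k j, (k < j)%N -> `|gamma k j| < 1.
Implicit Types (l n : nat).

Let d_gt0 l n : 0 < defect gamma l (n.+1 + l).
Proof. by apply: defect_gt0 => //; rewrite addSn ltnS leq_addl. Qed.

Lemma orthopoly_sharp0S l n : (orthopoly_sharp s gamma n.+1 l)`_0 =
  (orthopoly_sharp s gamma n l)`_0 / defect gamma l (n.+1 + l).
Proof. by rewrite orthopoly_sharpS coefZ coefD coefZ coefXM mulr0 add0r mulrC. Qed.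

Lemma orthopoly0S l n : (orthopoly s gamma n.+1 l)`_0 =
  - gamma l (n.+1 + l)%N * (orthopoly_sharp s gamma n l)`_0 / defect gamma l (n.+1 + l).
Proof. by rewrite orthopolyS coefZ coefB coefZ coefXM sub0r mulrC !mulNr. Qed.

Lemma orthopoly_sharp0_gt0 l n : 0 < (orthopoly_sharp s gamma n l)`_0.
Proof.
elim: n => [|n IH]; last by rewrite orthopoly_sharp0S divr_gt0.
rewrite -[orthopoly_sharp _ _ _ _]/((sqrtC (s l l))^-1)%:P coefC.
by rewrite invr_gt0 sqrtC_gt0 positive_kernel_diag.
Qed.

(** Both sides represent the functional taking the coefficient of X^0 on
    polynomials of degree at most n, for the form at level l. The recursion proves the identity directly:
    from n to n + 1 the left-hand side grows by the new term of the sum because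
    d^2 = 1 - |gamma|^2. *)
Lemma christoffel_darboux l n :
  (orthopoly_sharp s gamma n l)`_0 *: orthopoly_sharp s gamma n l =
  \sum_(k < n.+1) ((orthopoly s gamma k l)`_0)^* *: orthopoly s gamma k l.
Proof.
elim: n => [|n IH].
  rewrite big_ord1 -[orthopoly_sharp _ _ _ _]/((sqrtC (s l l))^-1)%:P.
  rewrite -[orthopoly _ _ _ _]/((sqrtC (s l l))^-1)%:P coefC; congr (_ *: _).
  by apply/esym/CrealP; rewrite gtr0_real // invr_gt0 sqrtC_gt0 positive_kernel_diag.
rewrite big_ord_recr /= -IH orthopoly_sharp0S orthopoly0S orthopoly_sharpS orthopolyS.
have b0 := orthopoly_sharp0_gt0 l n; have := defect_sqr gamma l (n.+1 + l); have := d_gt0 l n.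
set d := defect _ _ _; set g := gamma _ _; set b := (_`_0) in b0 *.
set A := 'X * _; set B := orthopoly_sharp _ _ _ _ => d0 d2.
have ec : (d^-1)^* = d^-1 by apply: CrealP; rewrite gtr0_real // invr_gt0.
have bc : b^* = b by apply: CrealP; rewrite gtr0_real.
(* The only use of the relation between d and gamma; the rest is polynomial. *)
have e2 : d^-1 ^+ 2 * (1 - g * g^*) = 1 by rewrite -d2 -exprMn mulVf ?expr1n // gt_eqF.
rewrite !(rmorphM, rmorphN) /= ec bc; move: e2; set e := d^-1 => e2.
apply/polyP => i; rewrite !(coefZ, coefD, coefN).
set x := A`_i; set y := B`_i.
transitivity (b * y + - g^* * b * e * (e * (x - g * y)) + b * y * (e ^+ 2 * (1 - g * g^*) - 1)).
  by ring.
by rewrite e2 subrr mulr0 addr0.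
Qed.

Lemma orthopoly_sharp0_sqr l n : (orthopoly_sharp s gamma n l)`_0 ^+ 2 =
  \sum_(k < n.+1) `|(orthopoly s gamma k l)`_0| ^+ 2.
Proof.
have := congr1 (fun p : {poly C} => p`_0) (christoffel_darboux l n).
rewrite coefZ -expr2 => ->; rewrite coef_sum; apply: eq_bigr => k _.
by rewrite coefZ normCK mulrC.
Qed.

End ChristoffelDarboux.

(** * Comparison of outer arrays *)

Section SingleRow.
Variable R : realType.
Local Notation C := R[i].
Implicit Types (T Theta : R1 R) (p : {poly C}) (v : nat -> C).

Lemma sqnorm_single v j : (forall i, i != j -> v i = 0) ->
  square_summable v /\ sqnorm v = `|v j| ^+ 2.
Proof.
move=> v0; apply: square_summableE; apply: (@ccvg_near_cst _ _ _ j.+1) => n jn.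
rewrite (bigD1 (Ordinal jn)) //= big1 ?addr0 // => i ij.
by rewrite v0 ?normr0 ?expr0n.
Qed.

(** All spaces but the one at j are zero, and that one is a line spanned by any of
    its nonzero elements, here the diagonal entry. *)
Lemma single_row_outer T j : (forall k i, k != j -> T k i = 0) -> T j j != 0 -> outer T.
Proof.
move=> T0 Tj; exists (fun i => i == j); split=> [i|k v [_ v0] e e0].
  split; first by apply: (sqnorm_single (j := j) _).1 => k kj; apply: T0.
  by move=> k /orP[ki|kj]; [apply: R1_lower | apply: T0].
(* For k > j the sum over k <= i < j.+1 is empty, which is right since then v = 0. *)
exists j.+1, (fun i => if i == j then v j / T j j else 0).
set w := fun i => _; suff w0 i : w i = 0.
  have [_ ->] := @sqnorm_single w 0%N (fun i _ => w0 i).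
  by rewrite w0 normr0 expr0n.
rewrite /w; have [->|ij] := eqVneq i j; last first.
  rewrite v0 ?ij ?orbT // big1 ?subr0 // => l _.
  by rewrite /column (T0 i l ij) mulr0.
have [kj|jk] := leqP k j; last by rewrite v0 ?jk // big_geq ?subr0.
rewrite big_nat_recr //= eqxx /column divfK // big_nat big1 ?add0r ?subrr // => l /andP[_ lj].
by rewrite (ltn_eqF lj) mul0r.
Qed.

Lemma single_row_kernel_le T j (K : nat -> nat -> C) : (forall k i, k != j -> T k i = 0) ->
  (forall p, `|tri_apply T p j| ^+ 2 <= kform K p p) -> kernel_le (gram T) K.
Proof.
move=> T0 TK; apply: kform_kernel_le => p.
have [|_ <-] := @kform_gram R T p.
  by move=> i; apply: (sqnorm_single (j := j) _).1 => k kj; apply: T0.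
have [|_ ->] := @sqnorm_single (tri_apply T p) j; last exact: TK.
by move=> k kj; rewrite /tri_apply big1 // => i _; rewrite T0 ?mul0r.
Qed.

(** For polynomials p = X^j + (terms of higher degree), row j of T p is the diagonal
    entry T j j. As Theta is outer, such p can be chosen with Theta p arbitrarily
    close to the vector carrying only the diagonal entry of Theta. *)
Lemma outer_diag_le T Theta j : outer T -> outer Theta -> kernel_le (gram T) (gram Theta) ->
  `|T j j| ^+ 2 <= `|Theta j j| ^+ 2.
Proof.
move=> [F' [T_sum _]] [F [Th_sum Th_tot]] le; apply/ler_addgt0Pr => e e0.
pose v i := if i == j then 0 else Theta i j.
have vh : hilbert_sum F j.+1 v.
  split=> [|i].
    have /square_summableP [M cM] := (Th_sum j).1; apply/square_summableP; exists M => n.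
    apply: le_trans (cM n); apply: ler_sum => i _; rewrite /v /column.
    by case: ifP => // _; rewrite normr0 expr0n exprn_ge0.
  rewrite /v ltnS leq_eqVlt -orbA => /orP[->//|H]; case: ifP => // _.
  exact: (Th_sum j).2.
have [N [x xe]] := Th_tot _ v vh e e0.
set w := (X in sqnorm X) in xe.
have ws : square_summable w.
  have := square_summableD vh.1 (@square_summableZ R (-1) _ (@square_summable_sum R nat
    (index_iota j.+1 N) xpredT (fun k i => x k * column Theta k i)
    (fun k _ => square_summableZ (c := x k) (Th_sum k).1))).
  by congr square_summable; apply/funext => i; rewrite mulN1r.
have [_ w_ub _] := sqnormP ws.
(* Theta p equals the diagonal entry at j and the small error w elsewhere. *)
pose p : {poly C} := 'X^j - \sum_(j.+1 <= k < N) x k *: 'X^k.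
have tp A i : tri_apply A p i = A i j - \sum_(j.+1 <= k < N) x k * A i k.
  rewrite /p -scaleN1r tri_applyD tri_applyZ tri_apply_Xn tri_apply_sum mulN1r.
  by congr (_ - _); apply: eq_bigr => k _; rewrite tri_applyZ tri_apply_Xn.
have tpj A : tri_apply A p j = A j j.
  rewrite tp big_nat big1 ?subr0 // => k /andP[jk _].
  by rewrite R1_lower ?mulr0.
have T_le : `|T j j| ^+ 2 <= kform (gram Theta) p p.
  apply: le_trans (tri_apply_le p j.+1 (fun i => (T_sum i).1) le).
  by rewrite big_ord_recr /= tpj lerDr sumr_ge0 // => r _; rewrite exprn_ge0.
apply: le_trans T_le _.
have [sq <-] := kform_gram p (fun i => (Th_sum i).1).
have [_ _ lub] := sqnormP sq; apply: lub => n.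
apply: (@le_trans _ _ (\sum_(r < n) ((r == j :> nat)%:R * `|Theta j j| ^+ 2 + `|w r| ^+ 2))).
  apply: ler_sum => r _; have [->|rj] := eqVneq (r : nat) j.
    by rewrite tpj mul1r lerDl exprn_ge0.
  by rewrite mul0r add0r tp /w /v (negbTE rj).
rewrite big_split; apply: lerD; last exact: le_trans (w_ub n) (ltW xe).
have [jn|nj] := ltnP j n.
  rewrite (bigD1 (Ordinal jn)) //= eqxx mul1r big1 ?addr0 // => r rj.
  by rewrite (negbTE (rj : val r != j)) mul0r.
rewrite big1 ?exprn_ge0 // => r _.
by rewrite ltn_eqF ?mul0r // (leq_trans _ nj).
Qed.

End SingleRow.

(** * Limits of the triangular arrays *)

Section Asymptotics.
Variable R : realType.
Local Notation C := R[i].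
Variables (s gamma : nat -> nat -> C) (Theta : R1 R).
Hypothesis s_pos : positive_kernel s.
Hypothesis s_gamma : is_parameters s gamma.
Hypothesis Theta_sf : is_spectral_factor s Theta.
Hypothesis Theta_diag : forall n, 0 < Theta n n.
Implicit Types (p q : {poly C}) (i j k n : nat).

Let gamma_lt1 : forall k j, (k < j)%N -> `|gamma k j| < 1 := s_gamma.1.
Let phi n j : {poly C} := 'X^j * orthopoly s gamma n j.
Let phis n j : {poly C} := 'X^j * orthopoly_sharp s gamma n j.
Let a n j := (orthopoly s gamma n j)`_0.
Let b n j := (orthopoly_sharp s gamma n j)`_0.

Let b_gt0 n j : 0 < b n j := orthopoly_sharp0_gt0 s_pos gamma_lt1 j n.

Let columns_summable j : square_summable (column Theta j).
Proof. by have [[F [H _]] _ _ _] := Theta_sf; have [] := H j. Qed.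

Let Theta_bound p n : \sum_(r < n) `|tri_apply Theta p r| ^+ 2 <= kform s p p.
Proof. by have [_ le _ _] := Theta_sf; apply: tri_apply_le. Qed.

(** The shift of the columns of Phi turns the array product into the action of
    Theta on X^j phi_n(X, j). *)
Lemma mul_Phi n k j : (Theta * Phi s gamma n) k j = tri_apply Theta (phi n j) k.
Proof. by rewrite R1_mul_entry; apply: eq_bigr => l _; rewrite coefXnM. Qed.

Lemma mul_Phi_sharp n k j : (Theta * Phi_sharp s gamma n) k j = tri_apply Theta (phis n j) k.
Proof. by rewrite R1_mul_entry; apply: eq_bigr => l _; rewrite coefXnM. Qed.

Lemma Phi_sharp_diag n j : Phi_sharp s gamma n j j = b n j.
Proof. by rewrite /= ltnn subnn. Qed.

(** Row k of Theta is a bounded functional, so by Bessel's inequality its values on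
    an orthonormal sequence are square-summable. *)
Lemma Theta_Phi_cvg0 : R1_cvg (fun n => Theta * Phi s gamma n) 0.
Proof.
apply/R1_cvgE => k j; rewrite R1_zero_entry; under eq_fun do rewrite mul_Phi.
pose v n := `|tri_apply Theta (phi n j) k| ^+ 2.
have vM n : \sum_(i < n) v i <= 1.
  apply: (@bessel R s (tri_apply Theta ^~ k) 1 (phi ^~ j) n) => //.
  - by move=> p q; apply: tri_applyD.
  - by move=> c p; apply: tri_applyZ.
  - move=> p; rewrite mul1r; apply: le_trans (Theta_bound p k.+1).
    by rewrite big_ord_recr /= lerDr sumr_ge0 // => r _; rewrite exprn_ge0.
  - by move=> i m; apply: kform_orthopoly.
have [|l [vl _ _]] := @nneg_series_cvg R v 1 _ vM; first by move=> i; rewrite exprn_ge0.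
apply: (@cvg0_squeeze R _ v); first by move=> n; rewrite [X in _ <= X]ger0_norm // exprn_ge0.
have := ccvgB (ccvg_shift vl) vl; rewrite subrr; congr ccvg; apply/funext => n.
by rewrite big_ord_recr /= [X in X - _]addrC addrK.
Qed.

Lemma Theta_Phi_sharp_diag n j : tri_apply Theta (phis n j) j = Theta j j * b n j.
Proof. by rewrite -mul_Phi_sharp R1_mul_diag Phi_sharp_diag. Qed.

(** X^j phi#_n(X, j) is a unit vector, Theta contracts, and row j of its image is
    the product of the two diagonal entries. *)
Lemma Theta_b_le1 n j : Theta j j ^+ 2 * b n j ^+ 2 <= 1.
Proof.
have := Theta_bound (phis n j) j.+1; rewrite kform_orthopoly_sharp //.
apply: le_trans; rewrite big_ord_recr /= Theta_Phi_sharp_diag ger0_norm ?exprMn.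
  by rewrite lerDr sumr_ge0 // => r _; rewrite exprn_ge0.
by rewrite mulr_ge0 // ltW.
Qed.

(** Since X^j phi#_n(X, j) is a unit vector orthogonal to all its terms but the
    lowest, its square norm is the product of its lowest coefficient with its
    product with X^j. *)
Lemma phis_Xj n j : kform s (b n j *: phis n j) 'X^j = 1.
Proof.
have bc : (b n j)^* = b n j by apply: CrealP; rewrite gtr0_real.
rewrite kformZl bc -(kform_orthopoly_sharp s_pos s_gamma j n).
have E : phis n j = \sum_(i < n.+1) (orthopoly_sharp s gamma n j)`_i *: 'X^(j + i).
  rewrite /phis [X in 'X^j * X](_ : _ = \sum_(i < n.+1) (orthopoly_sharp s gamma n j)`_i *: 'X^i).
    by rewrite mulr_sumr; apply: eq_bigr => i _; rewrite -scalerAr -exprD.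
  apply/polyP => i; rewrite -poly_def coef_poly; case: ltnP => // ni.
  by rewrite nth_default // (leq_trans (size_orthopolys s gamma n j).2).
rewrite -/(phis n j) {3}E kform_sumr big_ord_recl kformZr addn0 big1 ?addr0 // => i _.
rewrite kformZr kform_orthopoly_sharp_Xn ?mulr0 //=.
by rewrite addnS ltnS leq_addr -addnS leq_add2l ltn_ord.
Qed.

(** By the Christoffel-Darboux formula these numbers are the partial sums of a
    product of two sequences: the constant coefficients of the phi_k, whose
    squares sum to b n j ^+ 2, and the coordinates of X^i along the phi_k, which
    are square-summable by Bessel's inequality. *)
Lemma prediction_cvg j i (M : C) : (forall n, b n j ^+ 2 <= M) ->
  exists h : C, (fun n => kform s (b n j *: phis n j) 'X^i) ~~> h.
Proof.
move=> bM.
have sa : square_summable (fun k => (a k j)^*).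
  apply/square_summableP; exists M => -[|n].
    by rewrite big_ord0; apply: le_trans (bM 0%N); rewrite exprn_ge0 // ltW.
  under eq_bigr do rewrite norm_conjC.
  rewrite -(orthopoly_sharp0_sqr s_pos gamma_lt1); exact: bM.
have se : square_summable (fun k => kform s (phi k j) 'X^i).
  apply/square_summableP; exists (s i i) => n.
  under eq_bigr do rewrite (kformC 'X^i _ s_pos) norm_conjC.
  apply: (@bessel R s (kform s 'X^i) (s i i) (phi ^~ j) n).
  - by move=> p q; apply: kformDr.
  - by move=> c p; apply: kformZr.
  - exact/ltW/positive_kernel_diag.
  - by move=> p; rewrite -(kformXn s i i); apply: kform_cauchy_schwarz.
  - by move=> k m; apply: kform_orthopoly.
have [h hc] := square_summable_prod_cvg sa se; exists h.
move: (ccvg_shift hc); congr ccvg; apply/funext => n.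
rewrite /phis scalerAr (christoffel_darboux s_pos gamma_lt1) mulr_sumr kform_suml.
by apply: eq_bigr => k _; rewrite -scalerAr kformZl.
Qed.

(** The limit of the functionals p |-> <b phi#_n, p>, a multiple of the product with
    the part of X^j orthogonal to all higher powers. *)
Lemma prediction_functional j (M : C) : (forall n, b n j ^+ 2 <= M) ->
  exists h : nat -> C, [/\ h j = 1, forall i, (j < i)%N -> h i = 0
    & forall p, `|\sum_(i < size p) h i * p`_i| ^+ 2 <= M * kform s p p].
Proof.
move=> bM; have /choice[h hc] := fun i => @prediction_cvg j i M bM.
exists h; split.
- apply: (ccvg_unique (hc j)); apply: (@ccvg_near_cst _ _ _ 0%N) => n _.
  exact: phis_Xj.
- move=> i ji; apply: (ccvg_unique (hc i)); apply: (@ccvg_near_cst _ _ _ i) => n i_n.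
  by rewrite kformZl kform_orthopoly_sharp_Xn ?mulr0 // ji (leq_trans i_n) // leq_addl.
move=> p; rewrite -normrX.
have uc : (fun n => \sum_(i < size p) kform s (b n j *: phis n j) 'X^i * p`_i) ~~>
    \sum_(i < size p) h i * p`_i.
  by apply: ccvg_sum => i _; apply: ccvgM; [exact: hc | exact: ccvg_cst].
apply: norm_lim_le (ccvgM uc uc) _ => n.
have -> : \sum_(i < size p) kform s (b n j *: phis n j) 'X^i * p`_i = kform s (b n j *: phis n j) p.
  rewrite -[X in _ = kform s _ X]coefK poly_def kform_sumr.
  by apply: eq_bigr => i _; rewrite kformZr mulrC.
rewrite -expr2 normrX; apply: le_trans (kform_cauchy_schwarz _ _ s_pos) _.
have bc : (b n j)^* = b n j by apply: CrealP; rewrite gtr0_real.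
rewrite kformZl kformZr bc kform_orthopoly_sharp // mulr1 -expr2.
by apply: ler_wpM2r => //; apply: positive_kernel_ge0.
Qed.

(** The functional h / sqrt M, placed in row j, gives an outer array with Gram kernel
    below s. By maximality its Gram kernel is below that of Theta, and comparing
    diagonal entries gives 1 / M <= (Theta j j)^2. *)
Lemma Theta_b_ge1 j (M : C) : (forall n, b n j ^+ 2 <= M) -> 1 <= Theta j j ^+ 2 * M.
Proof.
move=> bM; have M0 : 0 < M by apply: lt_le_trans (bM 0%N); rewrite exprn_gt0.
have [h [hj h0 hM]] := prediction_functional bM.
pose c := (sqrtC M)^-1; have c0 : 0 < c by rewrite invr_gt0 sqrtC_gt0.
have c2 : c ^+ 2 = M^-1 by rewrite exprVn sqrtCK.
(* The truncation by lower_part changes nothing, as h vanishes beyond j. *)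
pose T := lower_part (fun k i => if k == j then c * h i else 0).
have TE k i : T k i = if k == j then c * h i else 0.
  rewrite /=; case: ifP => // ki; case: eqP => // kj.
  by rewrite h0 ?mulr0 // -kj.
have T0 k i : k != j -> T k i = 0 by move=> kj; rewrite TE (negbTE kj).
have Tj : T j j = c by rewrite TE eqxx hj mulr1.
have T_outer : outer T by apply: (single_row_outer T0); rewrite Tj gt_eqF.
have T_le : kernel_le (gram T) s.
  apply: (single_row_kernel_le T0) => p.
  rewrite (tri_applyE _ _ (leqnn _)).
  under eq_bigr do rewrite TE eqxx -mulrA.
  rewrite -mulr_sumr normrM exprMn gtr0_norm // c2 mulrC ler_pdivrMr // mulrC.
  exact: hM.
have [Th_outer _ Th_max _] := Theta_sf.
have := outer_diag_le j T_outer Th_outer (Th_max _ T_outer T_le).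
rewrite Tj gtr0_norm // gtr0_norm // c2 => cT.
by rewrite -(mulVf (lt0r_neq0 M0)) ler_pM2r.
Qed.

(** The squares b n j ^+ 2 increase to a limit, which is finite by Theta_b_le1;
    the two bounds on their product with the square of the diagonal entry force
    the limit of this product to be 1. *)
Lemma prediction_error_cvg j : (fun n => 1 - Theta j j ^+ 2 * b n j ^+ 2) ~~> 0.
Proof.
have t0 : 0 < Theta j j ^+ 2 by rewrite exprn_gt0.
have bt n : b n j ^+ 2 <= (Theta j j ^+ 2)^-1.
  by rewrite -(ler_pM2l t0) mulfV ?gt_eqF //; apply: Theta_b_le1.
have sumE n : \sum_(k < n.+1) `|a k j| ^+ 2 = b n j ^+ 2.
  by rewrite /b (orthopoly_sharp0_sqr s_pos gamma_lt1).
have sumM n : \sum_(k < n) `|a k j| ^+ 2 <= (Theta j j ^+ 2)^-1.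
  by case: n => [|n]; rewrite ?big_ord0 ?sumE // invr_ge0 ltW.
have [|l [al al_ub al_lub]] := @nneg_series_cvg R (fun k => `|a k j| ^+ 2) _ _ sumM.
  by move=> i; rewrite exprn_ge0.
have l1 : Theta j j ^+ 2 * l = 1.
  apply/eqP; rewrite eq_le Theta_b_ge1 ?andbT; last by move=> n; rewrite -sumE.
  by rewrite -ler_pdivlMl // mulr1; apply: al_lub.
have := ccvgB (@ccvg_cst R 1) (ccvgM (@ccvg_cst R (Theta j j ^+ 2)) (ccvg_shift al)).
by rewrite l1 subrr; congr ccvg; apply/funext => n; rewrite sumE.
Qed.

(** Column j has norm at most 1 and its diagonal entry tends to 1, so nothing is
    left for the other entries. *)
Lemma Theta_Phi_sharp_cvg1 : R1_cvg (fun n => Theta * Phi_sharp s gamma n) 1.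
Proof.
apply/R1_cvgE => k j; rewrite R1_one_entry; under eq_fun do rewrite mul_Phi_sharp.
have err_ge0 n : 0 <= 1 - Theta j j ^+ 2 * b n j ^+ 2 by rewrite subr_ge0 Theta_b_le1.
have [->|kj] := eqVneq k j.
  suff H : (fun n => 1 - tri_apply Theta (phis n j) j) ~~> 0.
    have := ccvgB (@ccvg_cst R 1) H; rewrite subr0; congr ccvg.
    by apply/funext => n; rewrite opprB addrC subrK.
  apply: cvg0_squeeze (prediction_error_cvg j) => n.
  rewrite [X in _ <= X]ger0_norm // Theta_Phi_sharp_diag -exprMn.
  set y := _ * _; have y0 : 0 <= y by rewrite mulr_ge0 // ltW.
  have y1 : y <= 1 by rewrite -(@expr_le1 _ 2) // exprMn Theta_b_le1.
  rewrite ger0_norm ?subr_ge0 //.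
  rewrite -subr_ge0 (_ : _ - _ = 2 * (y * (1 - y))); last by ring.
  by rewrite mulr_ge0 // mulr_ge0 // subr_ge0.
apply: cvg0_squeeze (prediction_error_cvg j) => n.
rewrite [X in _ <= X]ger0_norm // lerBrDr.
(* The range is just long enough to contain both the entries at k and at j. *)
have := Theta_bound (phis n j) (maxn k j).+1; rewrite kform_orthopoly_sharp //.
apply: le_trans.
have kM : (k < (maxn k j).+1)%N by rewrite ltnS leq_maxl.
have jM : (j < (maxn k j).+1)%N by rewrite ltnS leq_maxr.
rewrite (bigD1 (Ordinal kM)) //= (bigD1 (Ordinal jM)) /=; last by rewrite -val_eqE /= eq_sym.
rewrite Theta_Phi_sharp_diag [X in _ <= _ + (X ^+ 2 + _)]ger0_norm; last by rewrite mulr_ge0 // ltW.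
by rewrite exprMn lerD2l lerDl sumr_ge0 // => r _; rewrite exprn_ge0.
Qed.

Lemma spectral_factor_asymptotics :
  R1_cvg (Phi s gamma) 0 /\ R1_cvg (fun n => (Phi_sharp s gamma n)^-1) Theta.
Proof.
have Th0 k : Theta k k != 0 by rewrite gt_eqF.
have Th_unit : Theta \is a GRing.unit by apply: R1_unit_diag.
have Ps0 n k : Phi_sharp s gamma n k k != 0 by rewrite Phi_sharp_diag gt_eqF.
split.
  have := R1_cvg_mul (@R1_cvg_cst R Theta^-1) Theta_Phi_cvg0; rewrite mulr0.
  by congr R1_cvg; apply/funext => n; rewrite mulKr.
have inv_diag k : (Theta^-1) k k != 0.
  have := oner_neq0 C; rewrite -[1]/((true)%:R) -(eqxx k) -R1_one_entry -(mulVr Th_unit) R1_mul_diag.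
  by rewrite mulf_eq0 negb_or => /andP[].
have : R1_cvg (Phi_sharp s gamma) Theta^-1.
  have := R1_cvg_mul (@R1_cvg_cst R Theta^-1) Theta_Phi_sharp_cvg1; rewrite mulr1.
  by congr R1_cvg; apply/funext => n; rewrite mulKr.
by move=> /(R1_cvg_inv Ps0 inv_diag); rewrite invrK.
Qed.

End Asymptotics.

Theorem theorem3p3 (R : realType) (phi : {scalar P2 R})
    (gamma : nat -> nat -> R[i])
    (phi_pos : strictly_positive phi)
    (gamma_param : is_parameters (moment_kernel phi) gamma)
    (phi_szego : szego_class phi) :
  R1_cvg (Phi (moment_kernel phi) gamma) 0 /\
  R1_cvg (fun n => (Phi_sharp (moment_kernel phi) gamma n)^-1)
         (spectral_factor phi).
Proof.
apply: spectral_factor_asymptotics => //.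
  by move=> p p0; rewrite kform_moment; apply: phi_pos.
(* Positive diagonal entries exclude the default value 0 of the choice operator. *)
move: phi_szego; rewrite /szego_class /spectral_factor; case: xgetP => [T -> //|_ /(_ 0%N)].
by rewrite R1_zero_entry ltxx.
Qed.
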